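(* Let $p>2$ be a prime, $\Bbbk$ an algebraically closed field of characteristic $p$, and suppose $m\ge d$, where $m\ge1$, $d\ge0$. Then $\operatorname{Ext}^1_{T^{\mathsf Z}(m,d)}(L,L)=0$ for any irreducible $T^{\mathsf Z}(m,d)$-module $L$.
   Context: $\operatorname{Ext}^1$ is taken in the category of ungraded modules. Zigzag algebra: $\mathsf Z$ is the path algebra over $\mathbb{Z}$ of the quiver with vertices $J=\{1,\dots,p-1\}$ and arrows $\mathsf a_{k,j}$ from $j$ to $k$ whenever $|k-j|=1$, modulo: paths of length $\ge3$ are zero; length two paths that are not cycles are zero; all length two cycles at the same vertex are equal. $\mathsf e_j$ are the vertex idempotents ($\mathsf e_k\mathsf a_{k,j}\mathsf e_j=\mathsf a_{k,j}$), $\mathsf c_j:=\mathsf a_{j,j\pm1}\mathsf a_{j\pm1,j}$. It is graded by path length, and a superalgebra with $\mathsf a_{k,j}$ odd and $\mathsf e_j,\mathsf c_j$ even. $\mathsf B=\{\mathsf e_j,\mathsf c_j,\mathsf a_{k,j}\}$ is a $\mathbb{Z}$-basis. Zigzag Schur algebra: let $[m]=\{1,\dots,m\}$, and let $\xi^{\mathsf z}_{r,s}\in M_m(\mathsf Z)$ be the matrix with $\mathsf z$ in position $(r,s)$ and zeros elsewhere. $M_m(\mathsf Z)^{\otimes d}$ is the tensor product of superalgebras (usual sign rule), with $\mathfrak{S}_d$ acting on the right by place permutation with sign: $(\xi^{\mathsf z_1}_{r_1,s_1}\otimes\cdots\otimes\xi^{\mathsf z_d}_{r_d,s_d})^\sigma=(-1)^{N}\xi^{\mathsf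 z_{\sigma1}}_{r_{\sigma1},s_{\sigma1}}\otimes\cdots\otimes\xi^{\mathsf z_{\sigma d}}_{r_{\sigma d},s_{\sigma d}}$, $N=\#\{k<l:\sigma^{-1}k>\sigma^{-1}l,\ \mathsf z_k,\mathsf z_l\text{ odd}\}$. Put $S^{\mathsf Z}(m,d)_{\mathbb Z}:=(M_m(\mathsf Z)^{\otimes d})^{\mathfrak{S}_d}$. For a triple $(\mathbf b,\mathbf r,\mathbf s)\in\mathsf B^d\times[m]^d\times[m]^d$ in which $(b_k,r_k,s_k)=(b_l,r_l,s_l)$ with $k\ne l$ happens only for $b_k$ even, let $\xi^{\mathbf b}_{\mathbf r,\mathbf s}:=\sum(-1)^{\langle\mathbf b,\mathbf r,\mathbf s\rangle+\langle\mathbf b',\mathbf r',\mathbf s'\rangle}\xi^{b'_1}_{r'_1,s'_1}\otimes\cdots\otimes\xi^{b'_d}_{r'_d,s'_d}$, the sum over the distinct triples $(\mathbf b',\mathbf r',\mathbf s')$ in the $\mathfrak{S}_d$-orbit of $(\mathbf b,\mathbf r,\mathbf s)$ under simultaneous place permutation, where, for a fixed total order on $\mathsf B\times[m]\times[m]$, $\langle\mathbf b,\mathbf r,\mathbf s\rangle=\#\{k<l: b_k,b_l\text{ odd},(b_k,r_k,s_k)>(b_l,r_l,s_l)\}$. Let $\eta^{\mathbf b}_{\mathbf r,\mathbf s}:=\big(\prod_{j\in J,\,r,s\in[m]}\#\{k:(b_k,r_k,s_k)=(\mathsf c_j,r,s)\}!\big)\,\xi^{\mathbf b}_{\mathbf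 r,\mathbf s}$. The $\mathbb{Z}$-span $T^{\mathsf Z}(m,d)_{\mathbb Z}$ of all $\eta^{\mathbf b}_{\mathbf r,\mathbf s}$ is a unital graded subring of $S^{\mathsf Z}(m,d)_{\mathbb Z}$, and the zigzag Schur algebra is $T^{\mathsf Z}(m,d):=\Bbbk\otimes_{\mathbb Z}T^{\mathsf Z}(m,d)_{\mathbb Z}$. *)

(* Defs.v *)
From HB Require Import structures.
From mathcomp Require Import all_boot all_order all_algebra all_fingroup.
From mathcomp Require Import boolp.
From mathcomp Require Import ring zify.

Set Implicit Arguments.
Unset Strict Implicit.
Unset Printing Implicit Defensive.

Import GRing.Theory.
Local Open Scope ring_scope.
Local Open Scope quotient_scope.

(* The tensor product k (x)_Z A of two rings, as formal sums of pairs (c, a)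
   modulo the identifications that every biadditive map makes; see
   tensor_sum, pure_tensor_biadditive, pure_tensorM and tensor_universal. *)
Section TensorProduct.
Variables k A : pzRingType.

Definition biadditive (V : zmodType) (f : k -> A -> V) : Prop :=
  (forall c c' a, f (c + c') a = f c a + f c' a) /\
  (forall c a a', f c (a + a') = f c a + f c a').

Definition formal_eval (V : zmodType) (f : k -> A -> V) (s : seq (k * A)) : V :=
  \sum_(x <- s) f x.1 x.2.

Definition formal_eq (s t : seq (k * A)) : bool :=
  `[< forall (V : zmodType) (f : k -> A -> V),
        biadditive f -> formal_eval f s = formal_eval f t >].

Lemma formal_eqP s t : reflect (forall (V : zmodType) (f : k -> A -> V),
  biadditive f -> formal_eval f s = formal_eval f t) (formal_eq s t).
Proof. exact: asboolP. Qed.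

Lemma formal_eq_refl : reflexive formal_eq.
Proof. by move=> s; apply/formal_eqP. Qed.

Lemma formal_eq_sym : symmetric formal_eq.
Proof.
by move=> s t; apply/formal_eqP/formal_eqP => H V f bf; rewrite (H V f bf).
Qed.

Lemma formal_eq_trans : transitive formal_eq.
Proof.
move=> t s u /formal_eqP st /formal_eqP tu; apply/formal_eqP => V f bf.
by rewrite st // tu.
Qed.

Canonical formal_equiv :=
  EquivRel formal_eq formal_eq_refl formal_eq_sym formal_eq_trans.

Definition tensor : Type := {eq_quot formal_equiv}.
HB.instance Definition _ := Choice.on tensor.

Definition tensor_repr (x : tensor) : seq (k * A) :=
  generic_quotient.repr (x : {eq_quot formal_equiv}).

Definition pure_tensor (c : k) (a : A) : tensor :=
  \pi_({eq_quot formal_equiv}) [:: (c, a)].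

Definition tensor_lift (V : zmodType) (f : k -> A -> V) (x : tensor) : V :=
  formal_eval f (tensor_repr x).

Lemma tensor_lift_pi (V : zmodType) (f : k -> A -> V) s : biadditive f ->
  tensor_lift f (\pi_({eq_quot formal_equiv}) s) = formal_eval f s.
Proof.
move=> bf; rewrite /tensor_lift /tensor_repr; case: piP => t /eqmodP /= /formal_eqP st.
by rewrite st.
Qed.

Lemma tensor_ext (x y : tensor) :
  (forall (V : zmodType) (f : k -> A -> V),
    biadditive f -> tensor_lift f x = tensor_lift f y) -> x = y.
Proof.
move=> H; rewrite -[x](@reprK _ {eq_quot formal_equiv}).
rewrite -[y](@reprK _ {eq_quot formal_equiv}).
by apply/eqmodP/formal_eqP => V f bf; apply: H.
Qed.

Definition tensor_zero : tensor := \pi_({eq_quot formal_equiv}) [::].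
Definition tensor_add (x y : tensor) : tensor :=
  \pi_({eq_quot formal_equiv})
    (tensor_repr x ++ tensor_repr y).
Definition tensor_opp (x : tensor) : tensor :=
  \pi_({eq_quot formal_equiv})
    [seq (- u.1, u.2) | u <- tensor_repr x].
Definition tensor_one : tensor := pure_tensor 1 1.
Definition tensor_mul (x y : tensor) : tensor :=
  \pi_({eq_quot formal_equiv})
    [seq (u.1 * v.1, u.2 * v.2) | u <- tensor_repr x,
                                  v <- tensor_repr y].

Lemma tensor_lift0 (V : zmodType) (f : k -> A -> V) : biadditive f ->
  tensor_lift f tensor_zero = 0.
Proof. by move=> bf; rewrite tensor_lift_pi // /formal_eval big_nil. Qed.

Lemma tensor_liftD (V : zmodType) (f : k -> A -> V) x y : biadditive f ->
  tensor_lift f (tensor_add x y) = tensor_lift f x + tensor_lift f y.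
Proof. by move=> bf; rewrite tensor_lift_pi // /formal_eval big_cat. Qed.

Lemma biadditiveN (V : zmodType) (f : k -> A -> V) c a : biadditive f ->
  f (- c) a = - f c a.
Proof.
case=> fl fr; have f0 : f 0 a = 0 by apply: (addrI (f 0 a)); rewrite -fl !addr0.
by apply: (addIr (f c a)); rewrite -fl !addNr.
Qed.

Lemma tensor_liftN (V : zmodType) (f : k -> A -> V) x : biadditive f ->
  tensor_lift f (tensor_opp x) = - tensor_lift f x.
Proof.
move=> bf; rewrite tensor_lift_pi // /formal_eval big_map -sumrN.
by apply: eq_bigr => u _ /=; rewrite biadditiveN.
Qed.

Lemma tensor_lift_pure (V : zmodType) (f : k -> A -> V) c a : biadditive f ->
  tensor_lift f (pure_tensor c a) = f c a.
Proof. by move=> bf; rewrite tensor_lift_pi // /formal_eval big_seq1. Qed.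

Lemma tensor_liftM (V : zmodType) (f : k -> A -> V) x y : biadditive f ->
  tensor_lift f (tensor_mul x y) =
  tensor_lift (fun c a => tensor_lift (fun c' a' => f (c * c') (a * a')) y) x.
Proof.
move=> bf; rewrite tensor_lift_pi // /formal_eval.
by rewrite big_allpairs_dep; apply: eq_bigr.
Qed.

Lemma eq_tensor_lift (V : zmodType) (f g : k -> A -> V) x :
  (forall c a, f c a = g c a) -> tensor_lift f x = tensor_lift g x.
Proof. by move=> fg; apply: eq_bigr => u _. Qed.

Lemma biadditive_mull (V : zmodType) (f : k -> A -> V) c a :
  biadditive f -> biadditive (fun c' a' => f (c * c') (a * a')).
Proof. by case=> fl fr; split=> *; rewrite mulrDr ?fl ?fr. Qed.

Lemma biadditive_mulr (V : zmodType) (f : k -> A -> V) c a :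
  biadditive f -> biadditive (fun c' a' => f (c' * c) (a' * a)).
Proof. by case=> fl fr; split=> *; rewrite mulrDl ?fl ?fr. Qed.

Lemma biadditive_lift (V : zmodType) (f : k -> A -> V) y : biadditive f ->
  biadditive (fun c a => tensor_lift (fun c' a' => f (c * c') (a * a')) y).
Proof.
case=> fl fr; split=> *; rewrite -big_split /=; apply: eq_bigr => u _ /=;
  by rewrite mulrDl ?fl ?fr.
Qed.

Lemma tensor_addA : associative tensor_add.
Proof.
by move=> x y z; apply: tensor_ext => V f bf; rewrite !tensor_liftD // addrA.
Qed.

Lemma tensor_addC : commutative tensor_add.
Proof.
by move=> x y; apply: tensor_ext => V f bf; rewrite !tensor_liftD // addrC.
Qed.

Lemma tensor_add0 : left_id tensor_zero tensor_add.
Proof.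
move=> x; apply: tensor_ext => V f bf.
by rewrite tensor_liftD // tensor_lift0 // add0r.
Qed.

Lemma tensor_addN : left_inverse tensor_zero tensor_opp tensor_add.
Proof.
move=> x; apply: tensor_ext => V f bf.
by rewrite tensor_liftD // tensor_liftN // tensor_lift0 // addNr.
Qed.

Lemma tensor_mulA : associative tensor_mul.
Proof.
move=> x y z; apply: tensor_ext => V f bf.
have bl := biadditive_lift _ bf; rewrite !tensor_liftM //.
apply: eq_tensor_lift => c a; rewrite tensor_liftM; last exact: biadditive_mull.
by do 2!apply: eq_tensor_lift => ? ?; rewrite !mulrA.
Qed.

Lemma tensor_mul1l : left_id tensor_one tensor_mul.
Proof.
move=> x; apply: tensor_ext => V f bf; rewrite tensor_liftM //.
rewrite tensor_lift_pure; last exact: biadditive_lift.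
by apply: eq_tensor_lift => c a; rewrite !mul1r.
Qed.

Lemma tensor_mul1r : right_id tensor_one tensor_mul.
Proof.
move=> x; apply: tensor_ext => V f bf; rewrite tensor_liftM //.
apply: eq_tensor_lift => c a; rewrite tensor_lift_pure ?mulr1 //.
exact: biadditive_mull.
Qed.

Lemma tensor_mulDl : left_distributive tensor_mul tensor_add.
Proof.
move=> x y z; apply: tensor_ext => V f bf.
rewrite tensor_liftD // !tensor_liftM // tensor_liftD //.
exact: biadditive_lift.
Qed.

Lemma tensor_mulDr : right_distributive tensor_mul tensor_add.
Proof.
move=> x y z; apply: tensor_ext => V f bf.
rewrite tensor_liftD // !tensor_liftM // -big_split /=.
apply: eq_bigr => u _; rewrite tensor_liftD //; exact: biadditive_mull.
Qed.

HB.instance Definition _ := GRing.isZmodule.Build tensor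
  tensor_addA tensor_addC tensor_add0 tensor_addN.
HB.instance Definition _ := GRing.Zmodule_isPzRing.Build tensor
  tensor_mulA tensor_mul1l tensor_mul1r tensor_mulDl tensor_mulDr.

Lemma pure_tensor_biadditive : biadditive pure_tensor.
Proof.
by split=> *; apply: tensor_ext => V f bf; have [fl fr] := bf;
  rewrite tensor_liftD // !tensor_lift_pure.
Qed.

Lemma pure_tensorM c a c' a' :
  pure_tensor c a * pure_tensor c' a' = pure_tensor (c * c') (a * a').
Proof.
apply: tensor_ext => V f bf; rewrite tensor_liftM // !tensor_lift_pure //.
  exact: biadditive_mull.
exact: biadditive_lift.
Qed.

Lemma tensor_sum (x : tensor) :
  exists s : seq (k * A), x = \sum_(u <- s) pure_tensor u.1 u.2.
Proof.
exists (tensor_repr x); apply: tensor_ext => V f bf.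
rewrite {1}/tensor_lift; elim: (tensor_repr x) => [|u s IHs].
  by rewrite /formal_eval !big_nil tensor_lift0.
rewrite /formal_eval !big_cons tensor_liftD // tensor_lift_pure //.
by congr (_ + _).
Qed.

Lemma tensor_universal (V : zmodType) (f : k -> A -> V) : biadditive f ->
  exists! g : tensor -> V,
    (forall x y, g (x + y) = g x + g y) /\
    (forall c a, g (pure_tensor c a) = f c a).
Proof.
move=> bf; exists (tensor_lift f); split.
  by split=> *; rewrite ?tensor_liftD ?tensor_lift_pure.
move=> g [gD gp]; apply/funext => x; have [s ->] := tensor_sum x.
have g0 : g 0 = 0 by apply: (addrI (g 0)); rewrite -gD !addr0.
elim: s => [|u s IHs]; first by rewrite !big_nil tensor_lift0.
by rewrite !big_cons gD tensor_liftD // gp IHs tensor_lift_pure.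
Qed.

End TensorProduct.

Section Ext.
Variable R : pzRingType.

Definition irreducible_module (L : lmodType R) : Prop :=
  (exists x : L, x != 0) /\
  forall U : {pred L}, GRing.submod_closed U ->
    U =i pred1 0 \/ U =i predT.

(* Short exact sequences 0 -> N -> ext_mod -> M -> 0. *)
Record extension (M N : lmodType R) := Extension {
  ext_mod : lmodType R;
  ext_inj : {linear N -> ext_mod};
  ext_proj : {linear ext_mod -> M};
  ext_injP : injective ext_inj;
  ext_exact : forall x, ext_proj x = 0 <-> exists y, ext_inj y = x;
  ext_surj : forall z, exists x, ext_proj x = z
}.

Definition extension_equiv (M N : lmodType R) (E F : extension M N) : Prop :=
  exists f : {linear ext_mod E -> ext_mod F},
    [/\ bijective f,
        forall y, f (ext_inj E y) = ext_inj F y &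
        forall x, ext_proj F (f x) = ext_proj E x].

Section Split.
Variables M N : lmodType R.

Definition split_inj (y : N) : (N * M)%type := (y, 0).
Lemma split_inj_linear : linear split_inj.
Proof.
by move=> c x y; congr pair; rewrite /= scaler0 addr0.
Qed.
HB.instance Definition _ :=
  GRing.isLinear.Build R N (N * M)%type *:%R split_inj split_inj_linear.

Lemma split_injP : injective split_inj.
Proof. by move=> x y []. Qed.
Lemma split_exact (x : N * M) : snd x = 0 <-> exists y, split_inj y = x.
Proof. by case: x => y z /=; split=> [->|[? []]//]; exists y. Qed.
Lemma split_surj (z : M) : exists x : N * M, snd x = z.
Proof. by exists (0, z). Qed.

Definition split_extension : extension M N :=
  @Extension M N (N * M)%type split_inj snd split_injP split_exact split_surj.
End Split.

(* Ext^1(M, N) in Yoneda's sense is the set of equivalence classes of the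
   extensions 0 -> N -> E -> M -> 0, whose zero element is the class of the
   split extension; Ext^1(M, N) = 0 says that this is the only class. *)
Definition Ext1_vanishes (M N : lmodType R) : Prop :=
  forall E : extension M N, extension_equiv E (split_extension M N).

End Ext.

(* The zigzag algebra Z, through the multiplication table of its Z-basis
   {e_j, c_j, a_(k,j)}. The vertices 1, ..., n are represented by 'I_n. *)
Section Zigzag.
Variable n : nat.

Definition adjacent (k j : 'I_n) : bool := (k == j.+1 :> nat) || (j == k.+1 :> nat).

Lemma adjacent_sym k j : adjacent k j = adjacent j k.
Proof. exact: orbC. Qed.

Inductive zbasis :=
  | Ze of 'I_n
  | Zc of 'I_n
  | Za (k j : 'I_n) of adjacent k j.

Definition zcode (b : zbasis) : 'I_n + 'I_n + {kj : 'I_n * 'I_n | adjacent kj.1 kj.2} :=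
  match b with
  | Ze j => inl (inl j)
  | Zc j => inl (inr j)
  | Za k j kj => inr (exist _ (k, j) kj)
  end.

Definition zdecode (x : 'I_n + 'I_n + {kj : 'I_n * 'I_n | adjacent kj.1 kj.2}) :
    zbasis :=
  match x with
  | inl (inl j) => Ze j
  | inl (inr j) => Zc j
  | inr (exist (k, j) kj) => @Za k j kj
  end.

Lemma zcodeK : cancel zcode zdecode.
Proof. by case. Qed.

HB.instance Definition _ := Countable.copy zbasis (can_type zcodeK).
HB.instance Definition _ : isFinite zbasis := CanIsFinite zcodeK.

Definition zodd (b : zbasis) : bool := if b is Za _ _ _ then true else false.

(* The product of two basis elements is a basis element or 0 (None). *)
Definition zmul (b b' : zbasis) : option zbasis :=
  match b, b' with
  | Ze i, Ze j => if i == j then Some (Ze j) else None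
  | Ze i, Zc j => if i == j then Some (Zc j) else None
  | Zc i, Ze j => if i == j then Some (Zc j) else None
  | Ze i, Za k _ _ => if i == k then Some b' else None
  | Za _ j _, Ze i => if j == i then Some b else None
  | Za k j _, Za i l _ => if (j == i) && (k == l) then Some (Zc k) else None
  | _, _ => None
  end.

Lemma zmulA a b c : obind (zmul a) (zmul b c) = obind (fun x => zmul x c) (zmul a b).
Proof.
by case: a b c => [i|i|i i' h] [j|j|j j' h'] [k|k|k k' h''] //=;
  do ?[case: eqP => [?|?] //=; subst => //=]; rewrite ?eqxx //=;
  do ?[case: eqP => [?|?] //=; subst => //=]; rewrite ?eqxx ?andbF //=.
Qed.

Lemma zoddM a b c : zmul a b = Some c -> zodd c = zodd a (+) zodd b.
Proof.
case: a b => [i|i|i i' h] [j|j|j j' h'] //=; case: ifP => // _ [<-] //.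
Qed.

End Zigzag.

Section TensorPower.
Variables n m d : nat.

(* The letter (b, r, s) stands for the basis element xi^b_(r,s) of M_m(Z), with
   b placed in position (r, s), and a word (x_1, ..., x_d) for the basis
   element x_1 (x) ... (x) x_d of the tensor power of M_m(Z). *)
Definition letter : finType := (zbasis n * 'I_m * 'I_m)%type.

Definition lodd (x : letter) : bool := zodd x.1.1.

Definition lmul (x y : letter) : option letter :=
  if x.2 == y.1.2 then omap (fun b => (b, x.1.2, y.2)) (zmul x.1.1 y.1.1)
  else None.

Lemma lmulA x y z : obind (lmul x) (lmul y z) = obind (fun t => lmul t z) (lmul x y).
Proof.
case: x y z => [[b r] s] [[b' r'] s'] [[b'' r''] s''] /=; rewrite /lmul /=.
have [<-|ne1] := eqVneq s r'; have [<-|ne2] := eqVneq s' r'' => //=.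
- have := zmulA b b' b''.
  case: (zmul b' b'') => [c|] /=; case: (zmul b b') => [e|] //=;
    rewrite ?eqxx ?eqxx //= => E; first by rewrite E.
    by rewrite E.
  by rewrite -E.
- by case: (zmul b b') => //= e; rewrite (negPf ne2).
- by case: (zmul b' b'') => //= e; rewrite (negPf ne1).
Qed.

Lemma loddM x y z : lmul x y = Some z -> lodd z = lodd x (+) lodd y.
Proof.
rewrite /lmul; case: ifP => // _; case E: zmul => [c|] //= [<-].
exact: zoddM E.
Qed.

Definition word : finType := {ffun 'I_d -> letter}.

(* Product of two words, up to sign. *)
Definition wmul (u v : word) : option word :=
  if [forall k, lmul (u k) (v k)] then Some [ffun k => odflt (u k) (lmul (u k) (v k))]
  else None.

(* Sign rule: (x_1 (x) ... (x) x_d) (y_1 (x) ... (x) y_d) acquires a sign -1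
   for each odd x_k moved past an odd y_l with l < k. *)
Definition cross_sign (u v : word) : nat :=
  #|[set kl : 'I_d * 'I_d | [&& (kl.2 < kl.1)%N, lodd (u kl.1) & lodd (v kl.2)]]|.

(* M_m(Z)^(tensor d): x w is the coordinate of x on the basis word w. *)
Definition tpow : Type := {ffun word -> int}.
HB.instance Definition _ := GRing.Zmodule.copy tpow {ffun word -> int}.

Definition tpow_mul (x y : tpow) : tpow :=
  [ffun w => \sum_(u : word) \sum_(v : word | wmul u v == Some w)
               (-1) ^+ cross_sign u v * (x u * y v)].

Definition is_unit_letter (x : letter) : bool :=
  (if x.1.1 is Ze _ then true else false) && (x.1.2 == x.2).
Definition tpow_one : tpow :=
  [ffun w : word => if [forall k, is_unit_letter (w k)] then 1 else 0].

(* The sign of cross_sign as a product over pairs of positions. *)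
Definition xs (A B : 'I_d -> bool) : int :=
  \prod_(k < d) \prod_(l < d) (-1) ^+ [&& (l < k)%N, A k & B l].

Lemma sign_card (P : pred ('I_d * 'I_d)) :
  (-1) ^+ #|[set kl | P kl]| = \prod_(k < d) \prod_(l < d) (-1) ^+ P (k, l) :> int.
Proof.
rewrite pair_big /= -sum1_card big_mkcond /= -prodrXr.
by apply: eq_bigr => -[k l] _ /=; rewrite inE; case: (P _).
Qed.

Lemma cross_signE (u v : word) :
  (-1) ^+ cross_sign u v = xs (lodd \o u) (lodd \o v).
Proof. exact: sign_card. Qed.

Lemma xsDl A B C : xs (fun k => A k (+) B k) C = xs A C * xs B C.
Proof.
rewrite -big_split; apply: eq_bigr => k _ /=; rewrite -big_split.
apply: eq_bigr => l _ /=; rewrite -signr_addb; congr (_ ^+ _).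
by case: (l < k)%N; case: (A k); case: (B k); case: (C l).
Qed.

Lemma xsDr A B C : xs A (fun k => B k (+) C k) = xs A B * xs A C.
Proof.
rewrite -big_split; apply: eq_bigr => k _ /=; rewrite -big_split.
apply: eq_bigr => l _ /=; rewrite -signr_addb; congr (_ ^+ _).
by case: (l < k)%N; case: (A k); case: (B l); case: (C l).
Qed.

Lemma eq_xs A A' B B' : A =1 A' -> B =1 B' -> xs A B = xs A' B'.
Proof.
by move=> eA eB; do 2![apply: eq_bigr => ? _]; rewrite eA eB.
Qed.

Lemma xs_false A B : (forall k, A k = false) \/ (forall k, B k = false) -> xs A B = 1.
Proof.
move=> H; do 2![apply: big1 => ? _]; case: H => -> ; by rewrite /= ?andbF.
Qed.

Lemma wmulP (u v w : word) :
  reflect (forall k, lmul (u k) (v k) = Some (w k)) (wmul u v == Some w).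
Proof.
rewrite /wmul; apply: (iffP eqP).
  case: ifP => // /forallP H [<-] k; rewrite ffunE.
  by have := H k; case: lmul.
move=> H; rewrite ifT; last by apply/forallP => k; rewrite H.
by congr Some; apply/ffunP => k; rewrite ffunE H.
Qed.

Lemma wmulA (a b c : word) : obind (wmul a) (wmul b c) = obind (fun x => wmul x c) (wmul a b).
Proof.
have ext (x y : option word) : (forall w, (x == Some w) = (y == Some w)) -> x = y.
  case: x => [w|] H; first by apply/esym/eqP; rewrite -H.
  by case: y H => // w /(_ w); rewrite eqxx.
apply: ext => w.
have oP (x : option word) f (z : word) :
    reflect (exists2 t, x = Some t & f t = Some z) (obind f x == Some z).
  apply: (iffP eqP); last by case=> t -> /=.
  by case: x => //= t; exists t.
apply/oP/oP => -[t /eqP/wmulP H1 /eqP/wmulP H2].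
- have {}H k : obind (fun x => lmul x (c k)) (lmul (a k) (b k)) = Some (w k).
    by rewrite -lmulA H1 /= H2.
  exists [ffun k => odflt (a k) (lmul (a k) (b k))]; apply/eqP/wmulP => k;
    by rewrite ffunE; have := H k; case: lmul.
- have {}H k : obind (lmul (a k)) (lmul (b k) (c k)) = Some (w k).
    by rewrite lmulA H1 /= H2.
  exists [ffun k => odflt (a k) (lmul (b k) (c k))]; apply/eqP/wmulP => k;
    by rewrite ffunE; have := H k; case: lmul.
Qed.

Lemma wmul_odd (u v w : word) : wmul u v == Some w ->
  lodd \o w =1 (fun k => lodd (u k) (+) lodd (v k)).
Proof. by move=> /wmulP H k /=; apply: loddM. Qed.

Lemma sum_wmul (u v : word) (F : word -> int) :
  \sum_(w | wmul u v == Some w) F w = oapp F 0 (wmul u v).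
Proof.
case: (wmul u v) => [w|] /=; last exact: big_pred0.
by rewrite (eq_bigl (pred1 w)) ?big_pred1_eq // => t; rewrite eq_sym.
Qed.

(* Structure constants of tpow. *)
Definition gam (u v w : word) : int :=
  if wmul u v == Some w then (-1) ^+ cross_sign u v else 0.

Lemma tpow_mulE (x y : tpow) (w : word) :
  tpow_mul x y w = \sum_u \sum_v gam u v w * (x u * y v).
Proof.
rewrite ffunE; apply: eq_bigr => u _; rewrite big_mkcond; apply: eq_bigr => v _.
by rewrite /gam; case: ifP; rewrite ?mul0r.
Qed.

Lemma sum_gam (u v : word) (F : word -> int) :
  \sum_w gam u v w * F w = oapp (fun w => (-1) ^+ cross_sign u v * F w) 0 (wmul u v).
Proof.
rewrite -sum_wmul [RHS]big_mkcond; apply: eq_bigr => w _; rewrite /gam.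
by case: ifP; rewrite ?mul0r.
Qed.

Lemma gamA (a b c w : word) :
  \sum_u gam b c u * gam a u w = \sum_u gam a b u * gam u c w.
Proof.
rewrite !sum_gam; have := wmulA a b c.
case E1: (wmul b c) => [u|]; case E2: (wmul a b) => [v|] //=; rewrite /gam.
- move=> ->; case: ifP => [|]; last by rewrite !mulr0.
  rewrite !cross_signE => _.
  rewrite (eq_xs (frefl _) (wmul_odd (introT eqP E1))).
  rewrite (eq_xs (wmul_odd (introT eqP E2)) (frefl _)) xsDr xsDl.
  ring.
- by move=> ->; rewrite mulr0.
- by move=> <-; rewrite mulr0.
Qed.

Lemma tpow_mulA : associative tpow_mul.
Proof.
move=> x y z; apply/ffunP => w; rewrite !tpow_mulE.
transitivity (\sum_a \sum_b \sum_c (\sum_u gam b c u * gam a u w) * (x a * y b * z c)).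
  apply: eq_bigr => a _.
  under eq_bigr => u _ do rewrite tpow_mulE mulr_sumr mulr_sumr.
  rewrite exchange_big /=.
  apply: eq_bigr => b _.
  under eq_bigr => u _ do rewrite mulr_sumr mulr_sumr.
  rewrite exchange_big /=; apply: eq_bigr => c _; rewrite mulr_suml.
  apply: eq_bigr => u _; ring.
under eq_bigr => a _ do under eq_bigr => b _ do under eq_bigr => c _ do rewrite gamA.
transitivity (\sum_u \sum_c \sum_a \sum_b gam a b u * gam u c w * (x a * y b * z c)).
  rewrite [RHS]exchange_big /=.
  transitivity (\sum_a \sum_c \sum_b \sum_u gam a b u * gam u c w * (x a * y b * z c)).
    apply: eq_bigr => a _; rewrite exchange_big /=; apply: eq_bigr => c _.
    by apply: eq_bigr => b _; rewrite mulr_suml.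
  rewrite exchange_big /=; apply: eq_bigr => c _.
  rewrite [RHS]exchange_big /=; apply: eq_bigr => a _.
  by rewrite exchange_big.
apply: eq_bigr => u _; apply: eq_bigr => c _; rewrite tpow_mulE mulr_suml mulr_sumr.
apply: eq_bigr => a _; rewrite mulr_suml mulr_sumr; apply: eq_bigr => b _; ring.
Qed.

Lemma is_unit_letter_odd x : is_unit_letter x -> lodd x = false.
Proof. by case: x => [[[]]]. Qed.

Lemma lmul_unitl x y z : is_unit_letter x -> lmul x y = Some z -> y = z.
Proof.
case: x y => [[[i|i|i j h] r] s] [[b r'] s'] //= /eqP /= ->.
rewrite /lmul /=; case: eqP => //= <-.
by case: b => [j|j|j j' h] /=; case: eqP => //= E [<-] //; rewrite E.
Qed.

Lemma lmul_unitr x y z : is_unit_letter y -> lmul x y = Some z -> x = z.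
Proof.
case: y x => [[[i|i|i j h] r] s] [[b r'] s'] //= /eqP /= ->.
rewrite /lmul /=; case: eqP => //= <-.
by case: b => [j|j|j j' h] /=; case: eqP => //= E [<-] //; rewrite E.
Qed.

Definition lunit (x : letter) : letter :=
  (Ze (match x.1.1 with Ze j => j | Zc j => j | Za k _ _ => k end), x.1.2, x.1.2).
Definition runit (x : letter) : letter :=
  (Ze (match x.1.1 with Ze j => j | Zc j => j | Za _ j _ => j end), x.2, x.2).

Lemma lunitE x y : is_unit_letter y -> (lmul y x == Some x) = (y == lunit x).
Proof.
case: y x => [[[i|i|i j h] r] s] [[b r'] s'] //= /eqP /= ->.
rewrite /lmul /lunit /=; case: (eqVneq s r') => [->|ne] /=.
  rewrite !xpair_eqE eqxx !andbT /=.
  by case: b => [j|j|j j' h] /=; (have [E|ne] := eqVneq i j; first by rewrite E !eqxx); apply/esym/negbTE/eqP => -[] /eqP; rewrite (negPf ne).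
by apply/esym/negbTE/eqP => -[_ /eqP]; rewrite (negPf ne).
Qed.

Lemma runitE x y : is_unit_letter y -> (lmul x y == Some x) = (y == runit x).
Proof.
case: y x => [[[i|i|i j h] r] s] [[b r'] s'] //= /eqP /= ->.
rewrite /lmul /runit /=; case: (eqVneq s' s) => [->|ne] /=.
  rewrite !xpair_eqE eqxx !andbT /=.
  by case: b => [j|j|j j' h] /=; rewrite eq_sym; case: (eqVneq i _) => [->|ne] /=;
    rewrite ?eqxx //; apply/esym/negbTE/eqP => -[] /eqP; rewrite (negPf ne).
by apply/esym/negbTE/eqP => -[_ /eqP]; rewrite eq_sym (negPf ne).
Qed.

Lemma is_unit_lunit x : is_unit_letter (lunit x).
Proof. by rewrite /is_unit_letter /= eqxx. Qed.
Lemma is_unit_runit x : is_unit_letter (runit x).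
Proof. by rewrite /is_unit_letter /= eqxx. Qed.

Lemma tpow_mul1l : left_id tpow_one tpow_mul.
Proof.
move=> x; apply/ffunP => w; rewrite tpow_mulE.
pose u0 : word := [ffun k => lunit (w k)].
have u0P : forall k, is_unit_letter (u0 k) by move=> k; rewrite ffunE is_unit_lunit.
have key (u v : word) : (forall k, is_unit_letter (u k)) -> wmul u v == Some w ->
    u = u0 /\ v = w.
  move=> Hu /wmulP H; have vw : v = w.
    by apply/ffunP => k; apply: lmul_unitl (Hu k) (H k).
  split=> //; apply/ffunP => k; rewrite ffunE; apply/eqP.
  by rewrite -lunitE // -{1}vw H.
rewrite (bigD1 u0) //= [X in _ + X]big1 ?addr0; last first.
  move=> u ne; apply: big1 => v _; rewrite ffunE; case: ifP => [/forallP Hu|];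
    last by rewrite mul0r mulr0.
  rewrite /gam; case: ifP => [/(key _ _ Hu) [E _]|]; last by rewrite mul0r.
  by rewrite E eqxx in ne.
rewrite (bigD1 w) //= big1 ?addr0; last first.
  move=> v ne; rewrite /gam; case: ifP => [/(key _ _ u0P) [_ E]|]; last by rewrite mul0r.
  by rewrite E eqxx in ne.
rewrite /gam ifT; last by apply/wmulP => k; apply/eqP; rewrite lunitE // ffunE.
rewrite ffunE ifT ?cross_signE; last exact/forallP.
rewrite xs_false ?mul1r //; left=> k; exact: is_unit_letter_odd.
Qed.

Lemma tpow_mul1r : right_id tpow_one tpow_mul.
Proof.
move=> x; apply/ffunP => w; rewrite tpow_mulE exchange_big.
pose u0 : word := [ffun k => runit (w k)].
have u0P : forall k, is_unit_letter (u0 k) by move=> k; rewrite ffunE is_unit_runit.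
have key (u v : word) : (forall k, is_unit_letter (u k)) -> wmul v u == Some w ->
    u = u0 /\ v = w.
  move=> Hu /wmulP H; have vw : v = w.
    by apply/ffunP => k; apply: lmul_unitr (Hu k) (H k).
  split=> //; apply/ffunP => k; rewrite ffunE; apply/eqP.
  by rewrite -runitE // -{1}vw H.
rewrite (bigD1 u0) //= [X in _ + X]big1 ?addr0; last first.
  move=> u ne; apply: big1 => v _; rewrite ffunE; case: ifP => [/forallP Hu|];
    last by rewrite !mulr0.
  rewrite /gam; case: ifP => [/(key _ _ Hu) [E _]|]; last by rewrite mul0r.
  by rewrite E eqxx in ne.
rewrite (bigD1 w) //= big1 ?addr0; last first.
  move=> v ne; rewrite /gam; case: ifP => [/(key _ _ u0P) [_ E]|]; last by rewrite mul0r.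
  by rewrite E eqxx in ne.
rewrite /gam ifT; last by apply/wmulP => k; apply/eqP; rewrite runitE // ffunE.
rewrite ffunE ifT ?cross_signE; last exact/forallP.
rewrite xs_false ?mul1r ?mulr1 //; right=> k; exact: is_unit_letter_odd.
Qed.

Lemma tpow_mulDl : left_distributive tpow_mul +%R.
Proof.
move=> x y z; apply/ffunP => w; rewrite [RHS]ffunE !tpow_mulE -big_split /=.
apply: eq_bigr => u _; rewrite -big_split; apply: eq_bigr => v _ /=.
rewrite ffunE; ring.
Qed.

Lemma tpow_mulDr : right_distributive tpow_mul +%R.
Proof.
move=> x y z; apply/ffunP => w; rewrite [RHS]ffunE !tpow_mulE -big_split /=.
apply: eq_bigr => u _; rewrite -big_split; apply: eq_bigr => v _ /=.
rewrite ffunE; ring.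
Qed.

HB.instance Definition _ := GRing.Zmodule_isPzRing.Build tpow
  tpow_mulA tpow_mul1l tpow_mul1r tpow_mulDl tpow_mulDr.

End TensorPower.

(* Permutations supported in A that preserve f; used to show that the
   integral form below is closed under multiplication. *)
Section YoungSubgroup.
Variables (I : finType) (X : eqType) (f : I -> X).
Implicit Types (A : {set I}) (p : {perm I}).

Definition young A : {set {perm I}} :=
  [set p : {perm I} | perm_on A p && [forall k, f (p k) == f k]].

Lemma youngP A p : reflect (perm_on A p /\ forall k, f (p k) = f k) (p \in young A).
Proof.
rewrite inE; apply: (iffP andP) => -[pA H]; split=> //.
  by move=> k; apply/eqP/(forallP H).
by apply/forallP => k; apply/eqP.
Qed.

Lemma young_group_set A : group_set (young A).
Proof.
apply/group_setP; split.
  by apply/youngP; split; [exact: perm_on1 | move=> k; rewrite perm1].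
move=> p q /youngP[pA Hp] /youngP[qA Hq]; apply/youngP; split.
  exact: perm_onM.
by move=> k; rewrite permM Hq.
Qed.
Canonical young_group A := Group (young_group_set A).

Lemma perm_split A1 A2 p : [disjoint A1 & A2] -> perm_on (A1 :|: A2) p ->
    {in A1, forall k, p k \in A1} ->
  exists p1 p2, [/\ p = (p1 * p2)%g, perm_on A1 p1, perm_on A2 p2,
    {in A1, p1 =1 p} & {in A2, p2 =1 p}].
Proof.
move=> dA pA pA1; have pN : p \in 'N(A1 | 'P)%g.
  by rewrite !inE /=; apply/subsetP => k kA; rewrite !inE /= apermE pA1.
have p1on := restr_perm_on A1 p; have p1E := restr_permE pN.
set p1 := restr_perm A1 p in p1on p1E *.
have p2E k : k \notin A1 -> (p1^-1 * p)%g k = p k.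
  by move=> kA; rewrite permM (out_perm _ kA) // perm_onV.
exists p1, (p1^-1 * p)%g; split=> //; first by rewrite mulKVg.
  apply/subsetP => k; rewrite inE /=; apply: contraR => kA2.
  have [kA1|kA1] := boolP (k \in A1).
    rewrite permM -p1E; last by rewrite (perm_closed _ (perm_onV p1on)).
    by rewrite permKV.
  by rewrite p2E // (out_perm pA) // inE negb_or kA1.
move=> k kA; apply: p2E; apply: contraL kA => kA1.
by rewrite (disjointFr dA kA1).
Qed.

Lemma perm_on_fix A p k : perm_on A p -> k \notin A -> p k = k.
Proof. exact: out_perm. Qed.

Lemma card_youngU A1 A2 : [disjoint A1 & A2] ->
    (forall k l, f k = f l -> k \in A1 -> l \in A1) ->
  #|young (A1 :|: A2)| = (#|young A1| * #|young A2|)%N.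
Proof.
move=> dA sat; have -> : young (A1 :|: A2) = (young A1 * young A2)%g.
  apply/setP => p; apply/youngP/mulsgP.
    case=> pA Hp; have [|p1 [p2 [pE on1 on2 E1 E2]]] := perm_split dA pA.
      by move=> k; apply: sat; rewrite Hp.
    exists p1 p2; rewrite ?pE //; apply/youngP; split=> // k.
      have [kA|kA] := boolP (k \in A1); first by rewrite (E1 k kA) Hp.
      by rewrite (perm_on_fix on1).
    have [kA|kA] := boolP (k \in A2); first by rewrite (E2 k kA) Hp.
    by rewrite (perm_on_fix on2).
  case=> p1 p2 /youngP[on1 H1] /youngP[on2 H2] ->; split; last first.
    by move=> k; rewrite permM H2.
  by apply: perm_onM; [apply: subset_trans on1 _; exact: subsetUl
                      |apply: subset_trans on2 _; exact: subsetUr].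
apply: TI_cardMg; apply/trivgP/subsetP => p /setIP[/youngP[on1 _] /youngP[on2 _]].
apply/set1P/permP => k; rewrite perm1.
have [kA|kA] := boolP (k \in A1); last exact: perm_on_fix on1 _.
by apply: (perm_on_fix on2); rewrite (disjointFr dA kA).
Qed.

Lemma card_young (s : seq X) : uniq s ->
  #|young [set k | f k \in s]| = (\prod_(x <- s) #|[set k | f k == x]|`!)%N.
Proof.
elim: s => [_|x s IHs /= /andP[xs us]].
  rewrite big_nil; apply/eqP/cards1P; exists 1%g; apply/setP => p.
  apply/youngP/set1P => [[on1 _]|->].
    by apply/permP => k; rewrite perm1 (perm_on_fix on1) // !inE.
  by split=> [|k]; [exact: perm_on1 | rewrite perm1].
rewrite big_cons -IHs // -card_perm.
have -> : [set k | f k \in x :: s] = [set k | f k == x] :|: [set k | f k \in s].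
  by apply/setP => k; rewrite !inE.
rewrite card_youngU; first 1 last.
- rewrite -setI_eq0; apply/eqP/setP => k; rewrite !inE.
  by apply/negP => /andP[/eqP ->]; rewrite (negPf xs).
- by move=> k l E; rewrite !inE E.
congr (_ * _)%N; apply: eq_card => p; apply/youngP/idP => [[]//|on1].
split=> // k; have [kA|kA] := boolP (k \in [set k | f k == x]).
  have := kA; rewrite -(perm_closed _ on1) inE => /eqP ->.
  by move: kA; rewrite inE => /eqP ->.
by rewrite (perm_on_fix on1).
Qed.

End YoungSubgroup.

Section ZigzagSchur.
Variables n m d : nat.
Local Notation letter := (letter n m).
Local Notation word := (word n m d).
Local Notation tpow := (tpow n m d).
Implicit Types (w u v : word) (x y : tpow) (s : 'S_d).

(* w^s = (w_(s 1), ..., w_(s d)) *)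
Definition wperm w s : word := [ffun k => w (s k)].

(* The number N of the sign rule for place permutations. *)
Definition perm_sign s w : nat :=
  #|[set kl : 'I_d * 'I_d | [&& (kl.1 < kl.2)%N, (s^-1%g kl.2 < s^-1%g kl.1)%N,
                                lodd (w kl.1) & lodd (w kl.2)]]|.

(* (xi_w)^s = (-1)^N xi_(w^s): the coordinate of x^s on w is read off from the
   coordinate of x on w^(s^-1). *)
Definition tpow_act x s : tpow :=
  [ffun w => (-1) ^+ perm_sign s (wperm w s^-1) * x (wperm w s^-1)].

(* S^Z(m, d)_Z: the invariants of the symmetric group. *)
Definition schurZ : {pred tpow} := [pred x | [forall s, tpow_act x s == x]].

(* Repeated letters of w are even. *)
Definition valid w : bool :=
  [forall k, forall l, (k != l) && (w k == w l) ==> ~~ lodd (w k)].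

(* <b, r, s>; the total order on letters is the one given by enum_rank.
   Another order changes each xi w only by a sign. *)
Definition inv_sign w : nat :=
  #|[set kl : 'I_d * 'I_d | [&& (kl.1 < kl.2)%N,
       (enum_rank (w kl.2) < enum_rank (w kl.1))%N, lodd (w kl.1) & lodd (w kl.2)]]|.

Definition xi w : tpow :=
  [ffun w' => if [exists s, w' == wperm w s]
              then (-1) ^+ (inv_sign w + inv_sign w') else 0].

Definition cfact w : nat :=
  (\prod_(j < n) \prod_(r < m) \prod_(s < m) #|[set k | w k == (Zc j, r, s)]|`!)%N.

Definition eta w : tpow := xi w *+ cfact w.

(* T^Z(m, d)_Z: the Z-span of the eta w. *)
Definition zigzag_schurZ : {pred tpow} :=
  [pred x | `[< exists c : word -> int, x = \sum_(w | valid w) eta w *~ c w >]].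

Lemma wpermM w s t : wperm (wperm w s) t = wperm w (t * s).
Proof. by apply/ffunP => k; rewrite !ffunE permM. Qed.

Lemma wperm1 w : wperm w 1 = w.
Proof. by apply/ffunP => k; rewrite ffunE perm1. Qed.

Lemma wpermK s : cancel (wperm^~ s) (wperm^~ s^-1%g).
Proof. by move=> w; rewrite wpermM mulVg wperm1. Qed.

Lemma wpermKV s : cancel (wperm^~ s^-1%g) (wperm^~ s).
Proof. by move=> w; rewrite wpermM mulgV wperm1. Qed.

Lemma schurZP x : reflect
  (forall s w, x (wperm w s) = (-1) ^+ perm_sign s w * x w) (x \in schurZ).
Proof.
rewrite inE; apply: (iffP forallP) => [H s w|H s].
  by have /eqP/ffunP/(_ (wperm w s)) := H s; rewrite ffunE wpermK => <-.
by apply/eqP/ffunP => w; rewrite ffunE -H wpermKV.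
Qed.

Definition qs s (A : 'I_d -> bool) : int :=
  \prod_(k < d) \prod_(l < d)
    (-1) ^+ [&& (k < l)%N, (s^-1%g l < s^-1%g k)%N, A k & A l].

Lemma perm_signE s w : (-1) ^+ perm_sign s w = qs s (@lodd n m \o w).
Proof. exact: sign_card. Qed.

Lemma eq_qs s (A B : 'I_d -> bool) : A =1 B -> qs s A = qs s B.
Proof. by move=> e; do 2![apply: eq_bigr => ? _]; rewrite !e. Qed.

Lemma qs_even s (A : 'I_d -> bool) : (forall k, A k -> s k = k) -> qs s A = 1.
Proof.
move=> H; apply: big1 => k _; apply: big1 => l _.
have [Ak|] := boolP (A k); last by rewrite /= !andbF.
have [Al|] := boolP (A l); last by rewrite /= !andbF.
have e i : A i -> s^-1%g i = i by move=> Ai; rewrite -{1}(H i Ai) permK.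
by rewrite !e // andbT; case: ltngtP.
Qed.

Lemma prod_sign_mul (f g : 'I_d -> 'I_d -> bool) :
  (\prod_(k < d) \prod_(l < d) (-1) ^+ f k l) * (\prod_(k < d) \prod_(l < d) (-1) ^+ g k l) =
  \prod_(k < d) \prod_(l < d) (-1) ^+ (f k l (+) g k l) :> int.
Proof.
rewrite -big_split; apply: eq_bigr => k _; rewrite -big_split /=.
by apply: eq_bigr => l _; rewrite signr_addb.
Qed.

Lemma eq_prod_sign (f g : 'I_d -> 'I_d -> bool) : (forall k l, f k l = g k l) ->
  \prod_(k < d) \prod_(l < d) (-1) ^+ f k l = \prod_(k < d) \prod_(l < d) (-1) ^+ g k l :> int.
Proof. by move=> e; do 2![apply: eq_bigr => ? _]; rewrite e. Qed.

Lemma reindex_prod_sign s (f : 'I_d -> 'I_d -> bool) :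
  \prod_(k < d) \prod_(l < d) (-1) ^+ f k l = \prod_(k < d) \prod_(l < d) (-1) ^+ f (s k) (s l) :> int.
Proof.
rewrite (reindex_inj (@perm_inj _ s)); apply: eq_bigr => k _.
by rewrite (reindex_inj (@perm_inj _ s)).
Qed.

Lemma sym_prod_sign (f : 'I_d -> 'I_d -> bool) : (forall k, f k k = false) ->
  \prod_(k < d) \prod_(l < d) (-1) ^+ f k l =
  \prod_(k < d) \prod_(l < d) (-1) ^+ ((k < l)%N && (f k l (+) f l k)) :> int.
Proof.
move=> f0; transitivity ((\prod_(k < d) \prod_(l < d) (-1) ^+ ((k < l)%N && f k l)) *
   (\prod_(k < d) \prod_(l < d) (-1) ^+ ((k < l)%N && f l k)) : int).
  rewrite [X in _ * X]exchange_big /= prod_sign_mul; apply: eq_prod_sign => k l.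
  by case: ltngtP => //= [|/val_inj ->]; rewrite ?addbF ?f0.
rewrite prod_sign_mul; apply: eq_prod_sign => k l.
by case: (k < l)%N.
Qed.

Lemma xs_perm s (A B : 'I_d -> bool) :
  xs (A \o s) (B \o s) * qs s A * qs s B =
  xs A B * qs s (fun k => A k (+) B k).
Proof.
have -> : qs s (fun k => A k (+) B k) = qs s A * qs s B *
    (\prod_(k < d) \prod_(l < d) (-1) ^+ [&& (k < l)%N, (s^-1%g l < s^-1%g k)%N, A k & B l]) *
    (\prod_(k < d) \prod_(l < d) (-1) ^+ [&& (l < k)%N, (s^-1%g k < s^-1%g l)%N, A k & B l]).
  rewrite [X in _ = _ * X]exchange_big /= !prod_sign_mul; apply: eq_prod_sign => k l.
  case: (k < l)%N; case: (_ < _)%N; case: (A k); case: (A l); case: (B k);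
    by case: (B l).
have -> : xs (A \o s) (B \o s) = \prod_(k < d) \prod_(l < d)
    (-1) ^+ [&& (s^-1%g l < s^-1%g k)%N, A k & B l].
  rewrite [RHS](reindex_prod_sign s); apply: eq_prod_sign => k l /=.
  by rewrite !permK.
suff -> : \prod_(k < d) \prod_(l < d) (-1) ^+ [&& (s^-1%g l < s^-1%g k)%N, A k & B l] =
  xs A B *
    (\prod_(k < d) \prod_(l < d) (-1) ^+ [&& (k < l)%N, (s^-1%g l < s^-1%g k)%N, A k & B l]) *
    (\prod_(k < d) \prod_(l < d) (-1) ^+ [&& (l < k)%N, (s^-1%g k < s^-1%g l)%N, A k & B l])
  :> int by ring.
rewrite /xs !prod_sign_mul; apply: eq_prod_sign => k l.
case: (A k); case: (B l); rewrite /= ?andbF ?andbT //.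
case: (ltngtP (s^-1%g k) (s^-1%g l)) => [lt|lt|E] /=; last first.
- have -> : k = l by apply: (@perm_inj _ s^-1%g); apply: val_inj.
  by rewrite ltnn.
- by case: ltngtP => //= E; move: lt; rewrite (val_inj E) ltnn.
- by case: ltngtP => //= E; move: lt; rewrite (val_inj E) ltnn.
Qed.

Lemma qs_sq s (A : 'I_d -> bool) : qs s A * qs s A = 1.
Proof. by rewrite prod_sign_mul big1 // => k _; rewrite big1 // => l _; rewrite addbb. Qed.

Lemma wmul_perm u v w s :
  (wmul (wperm u s) (wperm v s) == Some (wperm w s)) = (wmul u v == Some w).
Proof.
apply/wmulP/wmulP => H k; last by rewrite !ffunE.
by have := H (s^-1%g k); rewrite !ffunE permKV.
Qed.

Lemma gam_perm u v w s :
  gam (wperm u s) (wperm v s) (wperm w s) *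
    (-1) ^+ perm_sign s u * (-1) ^+ perm_sign s v =
  (-1) ^+ perm_sign s w * gam u v w.
Proof.
rewrite /gam wmul_perm; case: ifP => [E|]; last by rewrite !mul0r mulr0.
rewrite !cross_signE !perm_signE (eq_qs s (wmul_odd E)) [RHS]mulrC -xs_perm.
by do 2!congr (_ * _); apply: eq_xs => k /=; rewrite ffunE.
Qed.

Lemma sqr_sign N : (-1) ^+ N * (-1) ^+ N = 1 :> int.
Proof. by rewrite -exprD addnn -mul2n exprM sqrrN !expr1n. Qed.

Lemma gam_schur x y u v w s : x \in schurZ -> y \in schurZ ->
  gam (wperm u s) (wperm v s) (wperm w s) * (x (wperm u s) * y (wperm v s)) =
  (-1) ^+ perm_sign s w * (gam u v w * (x u * y v)).
Proof.
move=> /schurZP Hx /schurZP Hy; rewrite Hx Hy [RHS]mulrA -gam_perm; ring.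
Qed.

Lemma schurZM x y : x \in schurZ -> y \in schurZ -> x * y \in schurZ.
Proof.
move=> Sx Sy; apply/schurZP => s w; rewrite !tpow_mulE mulr_sumr.
rewrite (reindex_inj (can_inj (wpermK s))); apply: eq_bigr => u _ /=.
rewrite mulr_sumr (reindex_inj (can_inj (wpermK s))); apply: eq_bigr => v _ /=.
exact: gam_schur.
Qed.

Lemma validP w :
  reflect (forall k l, k != l -> w k = w l -> lodd (w k) = false) (valid w).
Proof.
apply: (iffP forallP) => H k.
  by move=> l kl /eqP wkl; have /forallP/(_ l) := H k; rewrite kl wkl => /negbTE.
by apply/forallP => l; apply/implyP => /andP[kl /eqP wkl]; rewrite (H k l).
Qed.

Lemma schur_adj0 x w (k l : 'I_d) : x \in schurZ -> l = k.+1 :> nat ->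
  w k = w l -> lodd (w k) -> x w = 0.
Proof.
move=> /schurZP /(_ (tperm k l) w) Hx kl wkl ok.
have E : wperm w (tperm k l) = w.
  by apply/ffunP => i; rewrite ffunE; case: tpermP => // ->.
suff N1 : perm_sign (tperm k l) w = 1%N.
  by move: Hx; rewrite E N1; lia.
rewrite /perm_sign -(cards1 (k, l)); apply: eq_card => -[i j]; rewrite !inE /= tpermV.
rewrite xpair_eqE; apply/idP/idP => [/and4P[]|/andP[/eqP -> /eqP ->]].
  by case: tpermP => [->|->|/eqP + /eqP +]; case: tpermP => [->|->|/eqP + /eqP +];
    rewrite -!val_eqE /=; lia.
by rewrite tpermL tpermR -wkl ok kl /= leqnn.
Qed.

Lemma schur_invalid0 x w : x \in schurZ -> ~~ valid w -> x w = 0.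
Proof.
move=> Sx; rewrite negb_forall => /existsP[k0]; rewrite negb_forall => /existsP[l0].
rewrite negb_imply negbK -andbA => /and3P[kl0 /eqP wkl0 ok0].
have [k [l [lt_kl wkl ok]]] : exists k l : 'I_d, [/\ (k < l)%N, w k = w l & lodd (w k)].
  case: (ltngtP k0 l0) => [lt|lt|/val_inj E]; last by rewrite E eqxx in kl0.
    by exists k0, l0.
  by exists l0, k0; rewrite -wkl0.
have k1P : (k.+1 < d)%N by apply: leq_ltn_trans lt_kl (ltn_ord l).
pose k1 := Ordinal k1P; pose s := tperm k1 l.
have sk : s k = k by rewrite tpermD // -val_eqE /=; lia.
have x0 : x (wperm w s) = 0.
  apply: (@schur_adj0 _ _ k k1) => //; rewrite !ffunE sk // ?tpermL //.
by move: x0; move/schurZP: Sx => -> /eqP; rewrite mulf_eq0 signr_eq0 /= => /eqP.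
Qed.

Lemma inv_signE w : (-1) ^+ inv_sign w = \prod_(k < d) \prod_(l < d)
  (-1) ^+ [&& (k < l)%N, (enum_rank (w l) < enum_rank (w k))%N,
              lodd (w k) & lodd (w l)] :> int.
Proof. exact: sign_card. Qed.

Lemma inv_sign_perm w s : valid w ->
  (-1) ^+ inv_sign (wperm w s) = (-1) ^+ perm_sign s w * (-1) ^+ inv_sign w :> int.
Proof.
move=> /validP vw.
suff E : (-1) ^+ inv_sign (wperm w s) * (-1) ^+ inv_sign w =
         (-1) ^+ perm_sign s w :> int.
  by rewrite -E -mulrA sqr_sign mulr1.
rewrite perm_signE !inv_signE.
rewrite [X in X * _ = _](reindex_prod_sign s^-1%g) prod_sign_mul.
rewrite sym_prod_sign; last by move=> k; rewrite !ltnn.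
rewrite /qs; apply: eq_prod_sign => k l; rewrite !ffunE !permKV /=.
have [kl|//|//] := ltngtP k l.
case ok : (lodd (w k)); case ol : (lodd (w l)); rewrite /= ?andbF //= !andbT.
have ne : enum_rank (w l) != enum_rank (w k).
  apply/negP => /eqP/enum_rank_inj E.
  by rewrite (vw k l) // neq_ltn kl in ok.
have ne' : s^-1%g l != s^-1%g k.
  by apply/negP => /eqP/perm_inj E; rewrite E ltnn in kl.
move: ne ne'; rewrite -!val_eqE /=.
case: (ltngtP (enum_rank (w l)) (enum_rank (w k))) => // _ _;
  by case: (ltngtP (s^-1%g l) (s^-1%g k)).
Qed.

Lemma valid_perm w s : valid (wperm w s) = valid w.
Proof.
have imp w' t : valid w' -> valid (wperm w' t).
  move=> /validP H; apply/validP => k l kl; rewrite !ffunE => E.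
  by apply: (H _ (t l)); rewrite ?(inj_eq perm_inj).
by apply/idP/idP; [move/(imp _ s^-1%g); rewrite wpermK | exact: imp].
Qed.

Lemma cfact_perm w s : cfact (wperm w s) = cfact w.
Proof.
apply: eq_bigr => j _; apply: eq_bigr => r _; apply: eq_bigr => t _; congr _`!.
rewrite -(card_imset _ (@perm_inj _ s)); apply: eq_card => k.
apply/imsetP/idP => [[i]|]; rewrite !inE ?ffunE; first by move=> H ->.
by move=> H; exists (s^-1%g k); rewrite ?permKV // inE ffunE permKV.
Qed.

Definition orb w w' : bool := [exists s, w' == wperm w s].

Lemma orbP w w' : reflect (exists s, w' = wperm w s) (orb w w').
Proof. by apply: (iffP existsP) => -[s /eqP]; exists s => //; apply/eqP. Qed.

Lemma orb_perm w w' s : orb w (wperm w' s) = orb w w'.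
Proof.
apply/orbP/orbP => -[t E]; last by exists (s * t)%g; rewrite E wpermM.
by exists (s^-1 * t)%g; rewrite -wpermM -E wpermK.
Qed.

Lemma orb_refl w : orb w w.
Proof. by apply/orbP; exists 1%g; rewrite wperm1. Qed.

Lemma orb_sym w w' : orb w w' = orb w' w.
Proof.
by apply/orbP/orbP => -[s ->]; exists s^-1%g; rewrite wpermK.
Qed.

Lemma orb_eql w w' : orb w w' -> orb w =1 orb w'.
Proof.
by move=> /orbP[s ->] u; rewrite [RHS]orb_sym orb_perm orb_sym.
Qed.

Lemma xiE w w' : xi w w' = if orb w w' then (-1) ^+ (inv_sign w + inv_sign w') else 0.
Proof. by rewrite ffunE. Qed.

Lemma tpowMnE x N w : (x *+ N) w = x w *+ N.
Proof. by elim: N => [|N IHN]; rewrite ?mulr0n ?mulrS ffunE ?IHN. Qed.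

Lemma tpowMzE x (z : int) w : (x *~ z) w = x w * z.
Proof.
case: z => N; first by rewrite tpowMnE -mulr_natr natz.
by rewrite NegzE mulrNz [LHS]ffunE tpowMnE mulrN -mulr_natr natz.
Qed.

Lemma tpow_sumE (I : Type) (r : seq I) (P : pred I) (F : I -> tpow) w :
  (\sum_(i <- r | P i) F i) w = \sum_(i <- r | P i) F i w.
Proof.
by elim/big_rec2: _ => [|i a b _ <-]; rewrite ffunE.
Qed.

(* Membership by coordinates: x is S_d-invariant and the coordinate of x on
   each word w is divisible by cfact w. *)
Lemma zigzag_schurZP x : reflect
  (x \in schurZ /\ forall w, exists z, x w = z * (cfact w)%:Z)
  (x \in zigzag_schurZ).
Proof.
apply: (iffP (asboolP _)) => [[c ->]|[Sx Dx]].
  split.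
    apply/schurZP => s w; rewrite !tpow_sumE mulr_sumr; apply: eq_bigr => u vu.
    rewrite !tpowMzE !tpowMnE !xiE orb_perm; case: ifP => [/orbP[t E]|]; last first.
      by rewrite !mul0rn !mul0r mulr0.
    have vw : valid w by rewrite E valid_perm.
    rewrite !exprD inv_sign_perm //.
    rewrite -[X in X * _ = _]mulr_natr -[X in _ = _ * (X * _)]mulr_natr.
    move: ((-1) ^+ _) ((-1) ^+ _) ((-1) ^+ _) (_%:R) => a b e f.
    ring.
  move=> w; exists (\sum_(u | valid u) c u * xi u w).
  rewrite tpow_sumE mulr_suml; apply: eq_bigr => u vu.
  rewrite tpowMzE tpowMnE xiE; case: ifP => [/orbP[t ->]|]; last first.
    by rewrite mul0rn !mulr0 !mul0r.
  rewrite cfact_perm -mulr_natr natz.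
  move: ((-1) ^+ _) (Posz _) => a f; ring.
pose rep w := odflt w [pick u | orb w u].
have repP w : orb w (rep w).
  by rewrite /rep; case: pickP => //= /(_ w); rewrite orb_refl.
have repE w w' : orb w w' -> rep w = rep w'.
  move=> ww'; rewrite /rep (eq_pick (orb_eql ww')).
  by case: pickP => //= /(_ w'); rewrite orb_refl.
pose c u := if rep u == u then (x u %/ (cfact u)%:Z)%Z else 0.
exists c; apply/ffunP => w; rewrite tpow_sumE.
have [vw|nvw] := boolP (valid w); last first.
  rewrite schur_invalid0 // big1 // => u vu; rewrite tpowMzE tpowMnE xiE.
  case: ifP => [/orbP[t E]|]; last by rewrite mul0rn mul0r.
  by rewrite E valid_perm vu in nvw.
have /orbP[s E] := repP w.
rewrite (bigD1 (rep w)) /=; last by rewrite E valid_perm.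
rewrite big1 ?addr0 => [|u /andP[vu ne]]; last first.
  rewrite tpowMzE tpowMnE xiE; case: ifP => [ouw|]; last by rewrite mul0rn mul0r.
  rewrite /c ifF ?mulr0 //; apply: contraNF ne => /eqP <-.
  by rewrite (repE _ _ ouw).
rewrite tpowMzE tpowMnE xiE orb_sym repP /c -(repE _ _ (repP w)) eqxx -mulr_natr natz.
have cf0 : (cfact (rep w))%:Z != 0.
  by rewrite eqz_nat -lt0n !prodn_gt0 // => j; rewrite prodn_gt0 // => r;
     rewrite prodn_gt0 // => t; rewrite fact_gt0.
have [z Ez] := Dx (rep w); rewrite Ez mulzK //.
rewrite -mulrA [_ * z]mulrC -Ez E exprD inv_sign_perm //.
move/schurZP: Sx => ->.
have := sqr_sign (perm_sign s w); have := sqr_sign (inv_sign w).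
move: ((-1) ^+ inv_sign w) ((-1) ^+ perm_sign s w) (x w) => a b e Ha Hb.
by transitivity ((b * b) * (a * a) * e); [rewrite Ha Hb !mul1r | ring].
Qed.

Definition is_c (x : letter) : bool := if x.1.1 is Zc _ then true else false.

Definition clets : seq letter :=
  [seq (Zc t.1.1, t.1.2, t.2) | t <- enum {: 'I_n * 'I_m * 'I_m}].

Lemma mem_clets (x : letter) : (x \in clets) = is_c x.
Proof.
apply/mapP/idP => [[t _ ->]//|]; case: x => [[[j|j|//] r] s] //= _.
by exists (j, r, s); rewrite ?mem_enum.
Qed.

Lemma clets_uniq : uniq clets.
Proof.
rewrite map_inj_uniq ?enum_uniq // => -[[j r] s] [[j' r'] s'] /= [-> -> ->].
by [].
Qed.

Definition cpos w : {set 'I_d} := [set k | w k \in clets].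

Lemma cfactE w : cfact w = #|young w (cpos w)|.
Proof.
rewrite card_young ?clets_uniq // big_map big_enum /= /cfact.
rewrite pair_big /= pair_big /=; apply: eq_bigr => -[[j r] s] _.
by congr _`!; apply: eq_card => k; rewrite !inE.
Qed.

Lemma is_c_odd (x : letter) : is_c x -> lodd x = false.
Proof. by case: x => [[[]]]. Qed.

Lemma lmul_c (x y z : letter) : lmul x y = Some z -> is_c z -> ~~ lodd x -> is_c x || is_c y.
Proof.
case: x y => [[b r] s] [[b' r'] s']; rewrite /lmul /=; case: ifP => // _.
case: b b' => [i|i|i i' h] [j|j|j j' h'] //=; case: ifP => // _ [<-] //.
Qed.

Lemma lmul_cc (x y z : letter) : lmul x y = Some z -> is_c x -> is_c y -> False.
Proof.
case: x y => [[b r] s] [[b' r'] s']; rewrite /lmul /=; case: ifP => // _.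
by case: b b' => [i|i|i i' h] [j|j|j j' h'].
Qed.

Definition pair_act (p : word * word) s : word * word :=
  (wperm p.1 s^-1, wperm p.2 s^-1).

Lemma pair_act1 p : pair_act p 1 = p.
Proof. by case: p => u v; rewrite /pair_act invg1 !wperm1. Qed.

Lemma pair_actM p s t : pair_act p (s * t) = pair_act (pair_act p s) t.
Proof. by rewrite /pair_act !wpermM invMg. Qed.

Definition pair_action := TotalAction pair_act1 pair_actM.

Lemma stab_dvd u v w : valid u -> wmul u v == Some w ->
  (#|('C_(young w (cpos w))[(u, v) | pair_action])%g| %| cfact u * cfact v)%N.
Proof.
move=> /validP vu /wmulP H; rewrite !cfactE.
have dA : [disjoint cpos u & cpos v].
  rewrite -setI_eq0; apply/eqP/setP => k; rewrite !inE !mem_clets.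
  by apply/negP => /andP[]; apply: lmul_cc (H k).
have cA : young v (cpos v) \subset 'C(young u (cpos u))%g.
  apply/centsP => p /youngP[p2 _] q /youngP[q1 _].
  by apply: commute_sym; apply: perm_onC q1 p2 dA.
rewrite -TI_cardMg /=; last first.
  apply/trivgP/subsetP => p /setIP[/youngP[on1 _] /youngP[on2 _]].
  apply/set1P/permP => k; rewrite perm1.
  have [kA|kA] := boolP (k \in cpos u); last exact: perm_on_fix on1 _.
  by apply: (perm_on_fix on2); rewrite (disjointFr dA kA).
rewrite -cent_joinEr //; apply: cardSg; rewrite /= cent_joinEr //.
apply/subsetP => p /setIP[/youngP[pw _] /astab1P /= [Eu Ev]].
have up k : u (p k) = u k by rewrite -{1}Eu ffunE permK.
have vp k : v (p k) = v k by rewrite -{1}Ev ffunE permK.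
have pA : perm_on (cpos u :|: cpos v) p.
  apply/subsetP => k; rewrite inE => pk; have := subsetP pw k pk.
  rewrite !inE !mem_clets => ck; apply: lmul_c (H k) ck _.
  by rewrite -up (vu (p k) k pk (up k)).
have [|p1 [p2 [pE on1 on2 E1 E2]]] := perm_split dA pA.
  by move=> k; rewrite !inE up.
rewrite pE; apply: mem_mulg; apply/youngP; split=> // k.
  have [kA|kA] := boolP (k \in cpos u); first by rewrite (E1 k kA) up.
  by rewrite (perm_on_fix on1).
have [kA|kA] := boolP (k \in cpos v); first by rewrite (E2 k kA) vp.
by rewrite (perm_on_fix on2).
Qed.

Lemma young_sign w s : s \in young w (cpos w) -> (-1) ^+ perm_sign s w = 1 :> int.
Proof.
move=> /youngP[on _]; rewrite perm_signE; apply: qs_even => k /= ok.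
by apply: (perm_on_fix on); rewrite inE mem_clets; apply: contraL ok => /is_c_odd ->.
Qed.

(* The contributions to the coordinate of x * y on w are grouped by the orbits,
   on the pairs (u, v) with product w, of the group permuting equal letters
   c_j of w; that group has order cfact w. *)
Lemma zigzag_div x y w : x \in zigzag_schurZ -> y \in zigzag_schurZ ->
  exists z, (x * y) w = z * (cfact w)%:Z.
Proof.
move=> /zigzag_schurZP[Sx Dx] /zigzag_schurZP[Sy Dy].
pose t (p : word * word) := gam p.1 p.2 w * (x p.1 * y p.2).
have -> : (x * y) w = \sum_(p in [set: word * word]) t p.
  by rewrite tpow_mulE pair_big; apply: eq_bigl => p; rewrite !inE.
have actT : [acts young w (cpos w), on [set: word * word] | pair_action].
  by apply/actsP => s _ p; rewrite !inE.
have part := orbit_partition actT.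
have [/eqP covE trivO _] := and3P part.
rewrite -covE (big_trivIset _ trivO) /=.
elim/big_ind: _ => [|_ _ [a ->] [b ->]|]; first by exists 0; rewrite mul0r.
  by exists (a + b); rewrite mulrDl.
move=> _ /imsetP[[u v] _ ->].
have -> : \sum_(p in orbit pair_action (young w (cpos w)) (u, v)) t p =
    #|orbit pair_action (young w (cpos w)) (u, v)|%:Z * t (u, v).
  rewrite -[Posz _]natz -sumr_const mulr_suml; apply: eq_bigr => p /orbitP[s sY <-].
  have wE : wperm w s^-1 = w.
    have /youngP[_ Hs] := groupVr sY.
    by apply/ffunP => k; rewrite ffunE Hs.
  rewrite mul1r /t /=.
  by rewrite -{1}wE gam_schur // young_sign ?mul1r //; exact: groupVr.
have [E|nE] := boolP (wmul u v == Some w); last first.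
  by exists 0; rewrite /t /gam /= (negPf nE) !mul0r mulr0.
have [vu|nvu] := boolP (valid u); last first.
  by exists 0; rewrite /t /= (schur_invalid0 Sx nvu) !mul0r !mulr0.
have /dvdnP[q Eq] := stab_dvd vu E.
have Eo := card_orbit_stab pair_action (young_group w (cpos w)) (u, v).
have [a Ea] := Dx u; have [b Eb] := Dy v.
exists (gam u v w * a * b * q%:Z); rewrite /t /= Ea Eb [in RHS]cfactE -Eo PoszM.
have {}Eq : (cfact u)%:Z * (cfact v)%:Z =
    q%:Z * #|('C_(young w (cpos w))[(u, v) | pair_action])%g|%:Z.
  by rewrite -!PoszM Eq.
have F (o c g a' b' cu cv q' : int) : cu * cv = q' * c ->
    o * (g * (a' * cu * (b' * cv))) = g * a' * b' * q' * (o * c).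
  by move=> E1; transitivity (o * g * a' * b' * (cu * cv)); [ring | rewrite E1; ring].
exact: F.
Qed.

Lemma schurZ_zmod : zmod_closed schurZ.
Proof.
split=> [|x y /schurZP Hx /schurZP Hy]; apply/schurZP => s w.
  by rewrite !ffunE mulr0.
by rewrite ffunE [(- y) _]ffunE Hx Hy [in RHS]ffunE [(- y) w]ffunE mulrBr.
Qed.

Lemma perm_sign_unit s w : (forall k, is_unit_letter (w k)) -> (-1) ^+ perm_sign s w = 1 :> int.
Proof.
move=> H; rewrite perm_signE; apply: qs_even => k /=.
by rewrite is_unit_letter_odd.
Qed.

Lemma zigzag_schurZ1 : 1 \in zigzag_schurZ.
Proof.
have E w s : [forall k, is_unit_letter (wperm w s k)] = [forall k, is_unit_letter (w k)].
  apply/forallP/forallP => H k; last by rewrite ffunE.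
  by have := H (s^-1%g k); rewrite ffunE permKV.
apply/zigzag_schurZP; split.
  apply/schurZP => s w; rewrite !ffunE E; case: ifP => [/forallP H|]; last by rewrite mulr0.
  by rewrite perm_sign_unit.
move=> w; rewrite ffunE; case: ifP => [/forallP H|]; last by exists 0; rewrite mul0r.
exists 1; rewrite mul1r /cfact !big1 // => j _; rewrite !big1 // => r _.
rewrite big1 // => s _; rewrite (_ : [set k | _] = set0) ?cards0 //.
by apply/setP => k; rewrite !inE; apply/negP => /eqP Ek; have := H k; rewrite Ek.
Qed.

Lemma zigzag_schurZ_subring : subring_closed zigzag_schurZ.
Proof.
split=> [|x y /zigzag_schurZP[Sx Dx] /zigzag_schurZP[Sy Dy]|x y zx zy].
- exact: zigzag_schurZ1.
- apply/zigzag_schurZP; split; first exact: schurZ_zmod.2.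
  move=> w; have [a Ea] := Dx w; have [b Eb] := Dy w; exists (a - b).
  by rewrite ffunE [(- y) w]ffunE Ea Eb mulrBl.
- apply/zigzag_schurZP; split; last by move=> w; exact: zigzag_div.
  by apply: schurZM; [have /zigzag_schurZP[] := zx | have /zigzag_schurZP[] := zy].
Qed.

Lemma zigzag_schurZ_sub : {subset zigzag_schurZ <= schurZ}.
Proof. by move=> x /zigzag_schurZP[]. Qed.

Definition zigzag_schur_int : Type := {x : tpow | x \in zigzag_schurZ}.
HB.instance Definition _ := SubChoice.on zigzag_schur_int.
HB.instance Definition _ := GRing.SubChoice_isSubPzRing.Build tpow zigzag_schurZ
  zigzag_schur_int zigzag_schurZ_subring.

End ZigzagSchur.

Definition zigzag_schur (p : nat) (k : pzRingType) (m d : nat) : pzRingType :=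
  tensor k (zigzag_schur_int p.-1 m d).

(* Main.v *)
From HB Require Import structures.
Require Import Defs.
From mathcomp Require Import all_boot all_order all_algebra all_fingroup.
From mathcomp Require Import boolp zify.

Set Implicit Arguments.
Unset Strict Implicit.
Unset Printing Implicit Defensive.

Import GRing.Theory.
Local Open Scope ring_scope.

(** The algebra T is graded by path length, and a word in the letters (e_j, r, r)
    gives an idempotent of T: the sum of its orbit. Such orbits are the weights;
    a weight records how often each pair of a colour j and a row r occurs.

    Elements of positive degree generate a nilpotent ideal, so they kill an
    irreducible module L ([radical_kills]). Modulo that ideal the idempotents
    that sum up the weights with a given sum of colours are central, so L lives
    in a single colour sum s ([colour_idem_id]), and then so does every extension
    M of L by L. This is enough to see that positive degree kills M as well. Up
    to sign, each eta_w of positive degree is a product eta_u eta_v passing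
    through weights whose colour sum differs from the one at the right end of w
    ([eta_factor]): an arrow a_(k,j) = e_k a_(k,j) passes through k on its way
    from j, a cycle c_j = a_(j,i) a_(i,j) through a neighbour i of j. Two vertices
    give such a neighbour, and d <= m leaves room for d different middle indices,
    which makes the product a single orbit sum; the factorials in the definition
    of eta are exactly the multiplicities that this product produces.

    Thus only the degree zero part of T acts on M. It is built from classical
    Schur algebras, and the highest weight argument for quasi-hereditary algebras
    applies. An orbit sum of degree zero is the product of a lower triangular and
    an upper triangular one, up to orbit sums that are closer to the diagonal
    ([eta_triangular]). For a weight of least height among those that occur in L,
    with idempotent e, every triangular product that is not diagonal passes
    through a weight of smaller height, which does not occur in M; hence
    e T v = k v for v in e M ([weight_line]). If v in e M lifts a nonzero vector of
    e L, then T v maps onto L. If T v met the copy of L in M it would contain that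
    copy, so k v = e T v would contain a nonzero vector of L, although v does not
    map to 0. So T v is a complement of L in M. *)

(** * Words, grading and idempotents *)

Section Words.
Variables n m d : nat.
Local Notation letter := (letter n m).
Local Notation word := (word n m d).
Local Notation tpow := (tpow n m d).
Local Notation schurZ := (@schurZ n m d).
Local Notation zigzag_schurZ := (@zigzag_schurZ n m d).
Implicit Types (x y : tpow) (u v w z : word) (s : 'S_d) (P Q : pred word).

Definition lcolour (b : zbasis n) : 'I_n :=
  match b with Ze j => j | Zc j => j | Za k _ _ => k end.
Definition rcolour (b : zbasis n) : 'I_n :=
  match b with Ze j => j | Zc j => j | Za _ j _ => j end.

Definition letter_degree (x : letter) : nat :=
  match x.1.1 with Ze _ => 0%N | Zc _ => 2%N | Za _ _ _ => 1%N end.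
Definition degree w : nat := (\sum_k letter_degree (w k))%N.

Definition left_unit w : word := [ffun k => lunit (w k)].
Definition right_unit w : word := [ffun k => runit (w k)].
Definition unit_word w : bool := [forall k, is_unit_letter (w k)].

(** Predicates on orbits, such as the weight or the degree of a word. *)
Definition perm_invariant P := forall w s, P (wperm w s) = P w.

Definition restrict P x : tpow := [ffun w => if P w then x w else 0].
(** The sum of the weight idempotents whose weight satisfies P. *)
Definition idem P : tpow := restrict P 1.

Lemma letter_degreeM (a b c : letter) : lmul a b = Some c ->
  letter_degree c = (letter_degree a + letter_degree b)%N.
Proof.
case: a b => [[a r] s] [[b r'] s']; rewrite /lmul /=; case: ifP => // _.
by case: a b => [i|i|i i' h] [j|j|j j' h'] //=; case: ifP => // _ [<-].
Qed.

Lemma degreeM u v w : wmul u v == Some w -> degree w = (degree u + degree v)%N.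
Proof.
move=> /wmulP H; rewrite /degree -big_split.
by apply: eq_bigr => k _; apply: letter_degreeM.
Qed.

(** Composability: the middle colours and the middle matrix indices agree. *)
Lemma lmul_colour (a b c : letter) : lmul a b = Some c ->
  [/\ rcolour a.1.1 = lcolour b.1.1, a.2 = b.1.2,
      lcolour c.1.1 = lcolour a.1.1 /\ rcolour c.1.1 = rcolour b.1.1,
      c.1.2 = a.1.2 & c.2 = b.2].
Proof.
case: a b => [[a r] s] [[b r'] s']; rewrite /lmul /=; case: eqP => // <-.
by case: a b => [i|i|i i' h] [j|j|j j' h'] //=; do ?[case: eqP => //= ?]; subst;
  case=> <-.
Qed.

Lemma degree_perm w s : degree (wperm w s) = degree w.
Proof.
by rewrite /degree [RHS](reindex_inj (@perm_inj _ s)); apply: eq_bigr => k _;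
  rewrite ffunE.
Qed.

Lemma left_unit_perm w s : left_unit (wperm w s) = wperm (left_unit w) s.
Proof. by apply/ffunP => k; rewrite !ffunE. Qed.

Lemma right_unit_perm w s : right_unit (wperm w s) = wperm (right_unit w) s.
Proof. by apply/ffunP => k; rewrite !ffunE. Qed.

Lemma left_unit_id w : unit_word w -> left_unit w = w.
Proof.
move=> /forallP uw; apply/ffunP => k; rewrite ffunE.
by case: (w k) (uw k) => [[[j|j|j l h] r] s] //= /eqP /= ->.
Qed.

Lemma unit_word_perm w s : unit_word (wperm w s) = unit_word w.
Proof.
apply/forallP/forallP => H k; last by rewrite ffunE.
by have := H (s^-1%g k); rewrite ffunE permKV.
Qed.

Lemma oneE w : (1 : tpow) w = (unit_word w)%:R.
Proof. by rewrite ffunE /unit_word; case: ifP. Qed.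

Lemma tpowM x y w : (x * y) w = \sum_u \sum_v gam u v w * (x u * y v).
Proof. exact: tpow_mulE. Qed.

Lemma tpowD x y w : (x + y) w = x w + y w.
Proof. by rewrite ffunE. Qed.

Lemma tpowN x w : (- x) w = - x w.
Proof. by rewrite ffunE. Qed.

(** The idempotent restricts the coordinates to the words with left weight in P:
    after replacing 1 by [idem P] the only term of (1 * x) w that survives is the
    one with left factor [left_unit w]. *)
Lemma idem_mull P x w : (idem P * x) w = if P (left_unit w) then x w else 0.
Proof.
have -> : (idem P * x) w = (P (left_unit w))%:R * (1 * x) w.
  rewrite !tpowM mulr_sumr; apply: eq_bigr => u _; rewrite mulr_sumr.
  apply: eq_bigr => v _; rewrite ffunE oneE /gam.
  case: ifP => [/wmulP uvw|]; last by rewrite !mul0r mulr0.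
  have [uu|] := boolP (unit_word u); last by rewrite if_same !(mul0r, mulr0).
  suff -> : u = left_unit w by case: (P _); rewrite !(mul0r, mulr0, mul1r).
  apply/ffunP => k; rewrite ffunE; apply/eqP; rewrite -lunitE ?(forallP uu) //.
  by rewrite -{1}(lmul_unitl (forallP uu k) (uvw k)) uvw.
by rewrite mul1r; case: ifP; rewrite ?mul1r ?mul0r.
Qed.

Lemma idem_mulr P x w : (x * idem P) w = if P (right_unit w) then x w else 0.
Proof.
have -> : (x * idem P) w = (P (right_unit w))%:R * (x * 1) w.
  rewrite !tpowM mulr_sumr; apply: eq_bigr => u _; rewrite mulr_sumr.
  apply: eq_bigr => v _; rewrite ffunE oneE /gam.
  case: ifP => [/wmulP uvw|]; last by rewrite !mul0r mulr0.
  have [vv|] := boolP (unit_word v); last by rewrite if_same !(mul0r, mulr0).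
  suff -> : v = right_unit w by case: (P _); rewrite !(mul0r, mulr0, mul1r).
  apply/ffunP => k; rewrite ffunE; apply/eqP; rewrite -runitE ?(forallP vv) //.
  by rewrite -{1}(lmul_unitr (forallP vv k) (uvw k)) uvw.
by rewrite mulr1; case: ifP; rewrite ?mul1r ?mul0r.
Qed.

Lemma zigzagB x y :
  x \in zigzag_schurZ -> y \in zigzag_schurZ -> x - y \in zigzag_schurZ.
Proof. by have [_ B _] := zigzag_schurZ_subring n m d; apply: B. Qed.

Lemma zigzagM x y :
  x \in zigzag_schurZ -> y \in zigzag_schurZ -> x * y \in zigzag_schurZ.
Proof. by have [_ _ M] := zigzag_schurZ_subring n m d; apply: M. Qed.

Lemma restrict_zigzag P x : perm_invariant P ->
  x \in zigzag_schurZ -> restrict P x \in zigzag_schurZ.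
Proof.
move=> iP /zigzag_schurZP[/schurZP Sx Dx]; apply/zigzag_schurZP; split.
  by apply/schurZP => s w; rewrite !ffunE iP Sx; case: ifP; rewrite ?mulr0.
move=> w; rewrite ffunE; case: ifP => _; first exact: Dx.
by exists 0; rewrite mul0r.
Qed.

Lemma idem_zigzag P : perm_invariant P -> idem P \in zigzag_schurZ.
Proof. by move=> iP; apply/restrict_zigzag/zigzag_schurZ1. Qed.

Lemma eta_zigzag w : valid w -> eta w \in zigzag_schurZ.
Proof.
move=> vw; apply/asboolP; exists (fun u => (u == w)%:Z).
rewrite (bigD1 w) //= eqxx mulr1z big1 ?addr0 // => u /andP[_ /negPf ->].
by rewrite mulr0z.
Qed.

Lemma eta_schur w : valid w -> eta w \in schurZ.
Proof. by move/eta_zigzag; apply: zigzag_schurZ_sub. Qed.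

Lemma etaE w z : eta w z = xi w z *+ cfact w.
Proof. exact: tpowMnE. Qed.

Lemma xi_self w : xi w w = 1.
Proof. by rewrite xiE orb_refl exprD sqr_sign. Qed.

Lemma eta_self w : eta w w = (cfact w)%:R.
Proof. by rewrite etaE xi_self. Qed.

Lemma xi_out w z : ~~ orb w z -> xi w z = 0.
Proof. by rewrite xiE => /negPf ->. Qed.

Lemma eta_out w z : ~~ orb w z -> eta w z = 0.
Proof. by move=> wz; rewrite etaE xi_out // mul0rn. Qed.

Lemma perm_invariant_orb P w z : perm_invariant P -> orb w z -> P z = P w.
Proof. by move=> iP /orbP[s ->]; rewrite iP. Qed.

Lemma orb_invariant w : perm_invariant (orb w).
Proof. by move=> z s; rewrite orb_perm. Qed.

Lemma unit_orb u w : unit_word u -> orb u w -> unit_word w.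
Proof. by move=> uu uw; rewrite (perm_invariant_orb unit_word_perm uw). Qed.

(** Invariance determines the coordinates on an orbit from one of them; this is
    how products of orbit sums are identified below. *)
Lemma schur_eq_orb x y w : x \in schurZ -> y \in schurZ -> x w = y w ->
  {in orb w, x =1 y}.
Proof. by move=> /schurZP Sx /schurZP Sy E z /orbP[s ->]; rewrite Sx Sy E. Qed.

(** The coefficients come from those of an expansion over all valid words: the
    terms outside P have disjoint support and cancel among themselves. *)
Lemma zigzag_span P x : perm_invariant P -> x \in zigzag_schurZ ->
  (forall w, ~~ P w -> x w = 0) ->
  exists c : word -> int, x = \sum_(w | valid w && P w) eta w *~ c w.
Proof.
move=> iP /asboolP[c xE] x0; exists c; apply/ffunP => z; rewrite tpow_sumE.
have [Pz|nPz] := boolP (P z).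
  rewrite {1}xE tpow_sumE [RHS]big_mkcondr; apply: eq_bigr => w vw.
  case: ifP => // nPw; rewrite tpowMzE eta_out ?mul0r //.
  by apply: contraFN nPw => wz; rewrite -(perm_invariant_orb iP wz).
rewrite x0 // big1 // => w /andP[vw Pw]; rewrite tpowMzE eta_out ?mul0r //.
by apply: contra nPz => wz; rewrite (perm_invariant_orb iP wz).
Qed.

Lemma cfact1 w : (forall k l, is_c (w k) -> w k = w l -> k = l) -> cfact w = 1%N.
Proof.
move=> H; rewrite /cfact !big1 // => j _; rewrite big1 // => r _.
rewrite big1 // => s _.
suff : (#|[set k | w k == (Zc j, r, s)]| <= 1)%N by case: #|_| => [|[]].
apply/card_le1_eqP => k l; rewrite !inE => /eqP wk /eqP wl.
by symmetry; apply: H; rewrite ?wk ?wl.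
Qed.

Lemma even_valid w : (forall k, lodd (w k) = false) -> valid w.
Proof. by move=> ew; apply/validP. Qed.

Lemma degree0_vertex w : degree w = 0%N -> forall k, exists j, (w k).1.1 = Ze j.
Proof.
move=> /eqP; rewrite sum_nat_eq0 => /forallP w0 k; move: (w0 k).
by rewrite /letter_degree; case: (w k).1.1 => // j _; exists j.
Qed.

Lemma degree0_even w : degree w = 0%N -> forall k, lodd (w k) = false.
Proof. by move=> w0 k; rewrite /lodd; have [j ->] := degree0_vertex w0 k. Qed.

Lemma degree0_cfact w : degree w = 0%N -> cfact w = 1%N.
Proof.
by move=> w0; apply: cfact1 => k l; rewrite /is_c; have [j ->] := degree0_vertex w0 k.
Qed.

Lemma unit_degree0 w : unit_word w -> degree w = 0%N.
Proof.
move=> /forallP uw; apply: big1 => k _.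
by rewrite /letter_degree; case: (w k) (uw k) => [[[]]].
Qed.

Lemma even_inv_sign w : (forall k, lodd (w k) = false) -> inv_sign w = 0%N.
Proof.
move=> ew; apply/eqP; rewrite cards_eq0; apply/eqP/setP => -[k l].
by rewrite !inE /= ew ?andbF.
Qed.

Lemma even_cross_sign u v : (forall k, lodd (u k) = false) -> cross_sign u v = 0%N.
Proof.
move=> ew; apply/eqP; rewrite cards_eq0; apply/eqP/setP => -[k l].
by rewrite !inE /= ew ?andbF.
Qed.

Lemma degree0_xi w z : degree w = 0%N -> xi w z = (orb w z)%:R.
Proof.
move=> w0; rewrite xiE; case: ifP => // /orbP[s E].
have z0 : degree z = 0%N by rewrite E degree_perm.
by rewrite !even_inv_sign //; apply: degree0_even.
Qed.

Lemma degree0_eta w : degree w = 0%N -> eta w = xi w.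
Proof. by move=> w0; rewrite /eta degree0_cfact. Qed.

(** Even words carry no signs, so the orbit sum of a unit word is its weight idempotent. *)
Lemma unit_eta u : unit_word u -> eta u = idem (orb u).
Proof.
move=> uu; apply/ffunP => z; rewrite degree0_eta ?unit_degree0 //.
rewrite degree0_xi ?unit_degree0 // ffunE oneE; case: ifP => // uz.
by rewrite (unit_orb uu uz).
Qed.

Lemma eta_idem P w : perm_invariant P ->
  eta w * idem P = if P (right_unit w) then eta w else 0.
Proof.
move=> iP; apply/ffunP => z; rewrite idem_mulr.
have [/orbP[s ->]|nwz] := boolP (orb w z); last first.
  by rewrite eta_out // if_same; case: ifP => _; rewrite ?eta_out // ffunE.
by rewrite right_unit_perm iP; case: ifP => // _; rewrite ffunE.
Qed.

Lemma idem_eta P w : perm_invariant P ->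
  idem P * eta w = if P (left_unit w) then eta w else 0.
Proof.
move=> iP; apply/ffunP => z; rewrite idem_mull.
have [/orbP[s ->]|nwz] := boolP (orb w z); last first.
  by rewrite eta_out // if_same; case: ifP => _; rewrite ?eta_out // ffunE.
by rewrite left_unit_perm iP; case: ifP => // _; rewrite ffunE.
Qed.

Lemma idem_idem P Q : perm_invariant P -> idem P * idem Q = idem (predI P Q).
Proof.
move=> iP; apply/ffunP => w; rewrite idem_mull !ffunE.
have [uw|nuw] := boolP (unit_word w).
  by rewrite left_unit_id //=; case: (P w).
have -> : (if [forall k, is_unit_letter (w k)] then 1 else 0) = 0 :> int by rewrite ifN.
by rewrite !if_same.
Qed.

End Words.

(** * Products of orbit sums with rigid matching *)

Section RigidProducts.
Variables n m d : nat.
Local Notation letter := (letter n m).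
Local Notation word := (word n m d).
Local Notation tpow := (tpow n m d).
Local Notation schurZ := (@schurZ n m d).
Implicit Types (x y : tpow) (u v w z : word) (s : 'S_d).

Lemma sum_neq0 (I : finType) (F : I -> int) :
  \sum_i F i != 0 -> exists i, F i != 0.
Proof.
move=> nz; apply/existsP; apply: contraR nz; rewrite negb_exists => /forallP F0.
by rewrite big1 // => i _; apply/eqP; have := F0 i; rewrite negbK.
Qed.

Lemma xi_neq0 w z : xi w z != 0 -> orb w z.
Proof. by apply: contraR => /xi_out ->. Qed.

(** The product of two orbit sums is a sum over the ways of matching their
    letters. When the middle index of u k determines the letter of v that fits,
    every matching is a simultaneous permutation of the pair (u, v), so only the
    orbit of w occurs. The matchings with product w are permuted transitively and
    freely by the permutations of equal letters c_j of w, which accounts for the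
    factor [cfact w] of [eta w]; the letters c_j are even, so all these terms have
    the same sign. *)
Lemma eta_rigid u v w :
  valid u -> valid v -> valid w -> cfact u = 1%N -> cfact v = 1%N ->
  wmul u v == Some w ->
  (forall k l c, lmul (u k) (v l) = Some c -> v k = v l) ->
  (forall k l, w k = w l -> ~~ is_c (w k) -> u k = u l) ->
  (forall k l, is_c (w k) -> u k = u l -> k = l) ->
  eta w = eta u * eta v \/ eta w = - (eta u * eta v).
Proof.
move=> vu vv vw u1 v1 uvw match_v eq_u inj_u.
have uvw' := wmulP _ _ _ uvw.
have v_of_u k l : u k = u l -> v k = v l.
  by move=> E; symmetry; apply: (match_v _ _ (w k)); rewrite -E.
have Su := eta_schur vu; have Sv := eta_schur vv.
have etau z : eta u z = xi u z by rewrite etaE u1.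
have etav z : eta v z = xi v z by rewrite etaE v1.
pose t z (p : word * word) := gam p.1 p.2 z * (eta u p.1 * eta v p.2).
have supp z p : t z p != 0 -> exists s, p = (wperm u s, wperm v s) /\ z = wperm w s.
  case: p => a b; rewrite /t /= !mulf_eq0 !negb_or etau etav.
  case/andP => gnz /andP[/xi_neq0/orbP[s aE] /xi_neq0/orbP[s' bE]].
  have /wmulP abz : wmul a b == Some z by move: gnz; rewrite /gam; case: ifP.
  have bE' : b = wperm v s.
    rewrite bE; apply/ffunP => k; rewrite !ffunE; symmetry.
    by apply: (match_v _ _ (z k)); have := abz k; rewrite aE bE !ffunE.
  exists s; rewrite aE bE'; split=> //; apply/ffunP => k; rewrite ffunE.
  by apply: Some_inj; rewrite -abz -uvw' aE bE' !ffunE.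
have prodE z : (eta u * eta v) z = \sum_p t z p by rewrite tpowM pair_big.
have Sx : eta u * eta v \in schurZ by apply: schurZM.
have x_out z : ~~ orb w z -> (eta u * eta v) z = 0.
  move=> wz; apply/eqP; rewrite prodE; apply: contraR wz => /sum_neq0[p].
  by move=> /supp[s [_ ->]]; rewrite orb_perm orb_refl.
have Yp s : s \in young w (cpos w) -> wperm w s^-1%g = w.
  move=> /groupVr /youngP[_ Hs].
  by apply/ffunP => k; rewrite ffunE Hs.
have xw : (eta u * eta v) w = (cfact w)%:R * (-1) ^+ cross_sign u v.
  rewrite prodE (bigID (mem (orbit (@pair_action n m d) (young w (cpos w)) (u, v)))) /=.
  rewrite [X in _ + X]big1 ?addr0; last first.
    move=> p; apply: contraNeq => /supp[s [-> wE]].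
    have ws k : w (s k) = w k by rewrite [in RHS]wE ffunE.
    (* s fixes w, but may also permute equal letters e_j. Its restriction s1 to
       the letters c_j has the same effect on u and v, and lies in the group. *)
    have dA : [disjoint cpos w & ~: cpos w] by rewrite -setI_eq0 setICr.
    have [||s1 [s2 [_ on1 _ E1 _]]] := @perm_split _ _ _ s dA.
    - by rewrite setUCr; apply/subsetP => k _; rewrite !inE.
    - by move=> k; rewrite !inE ws.
    have us1 k : u (s1 k) = u (s k).
      have [kA|kA] := boolP (k \in cpos w); first by rewrite E1.
      rewrite (perm_on_fix on1) //; apply: eq_u; first by rewrite ws.
      by move: kA; rewrite inE mem_clets.
    have s1Y : s1 \in young w (cpos w).
      apply/youngP; split=> // k.
      have [kA|kA] := boolP (k \in cpos w); first by rewrite E1.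
      by rewrite (perm_on_fix on1).
    apply/orbitP; exists s1^-1%g; first exact: groupVr.
    rewrite /= /pair_act /= invgK; congr pair; apply/ffunP => k; rewrite !ffunE //.
    exact: v_of_u.
  rewrite (eq_bigr (fun=> t w (u, v))) => [|p /orbitP[s sY <-]]; last first.
    by rewrite /t /= -{1}(Yp s sY) gam_schur // young_sign ?mul1r //; exact: groupVr.
  rewrite sumr_const -[LHS]mulr_natl; congr (_%:R * _).
    rewrite cfactE.
    rewrite -(card_orbit_stab (@pair_action n m d) (young_group w (cpos w)) (u, v)).
    suff -> : ('C_(young w (cpos w))[(u, v) | @pair_action n m d] = 1)%g.
      by rewrite cards1 muln1.
    apply/trivgP/subsetP => s /setIP[/youngP[on_s _] /astab1P /= [Eu _]].
    apply/set1P/permP => k; rewrite perm1.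
    have [kA|kA] := boolP (k \in cpos w); last exact: perm_on_fix on_s _.
    have E : u k = u (s k) by rewrite -{2}Eu ffunE permK.
    by symmetry; apply: inj_u E; move: kA; rewrite inE mem_clets.
  by rewrite /t /gam /= uvw !eta_self u1 v1 !mulr1.
(* Both sides are supported on the orbit of w, so the coordinates on w decide. *)
have agree y : y \in schurZ -> y w = eta w w -> (forall z, ~~ orb w z -> y z = 0) ->
    eta w = y.
  move=> Sy Ey y0; apply/ffunP => z; have [wz|wz] := boolP (orb w z).
    by symmetry; apply: (schur_eq_orb Sy (eta_schur vw) Ey).
  by rewrite eta_out // y0.
have := xw; rewrite -signr_odd; case: odd; rewrite ?expr0 ?expr1 ?mulrN !mulr1 => E.
  right; apply: agree.
  - by rewrite -sub0r; apply: (schurZ_zmod n m d).2 => //; exact: (schurZ_zmod n m d).1.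
  - by rewrite tpowN E opprK eta_self.
  - by move=> z wz; rewrite tpowN x_out ?oppr0.
by left; apply: agree => //; rewrite E eta_self.
Qed.

End RigidProducts.

(** * Elements of positive degree factor through another colour content *)

Section PositiveDegree.
Variables n m d : nat.
Hypotheses (n_gt1 : (1 < n)%N) (d_le_m : (d <= m)%N).
Local Notation letter := (letter n m).
Local Notation word := (word n m d).
Implicit Types (u v w : word).

(** On unit words this is constant on weights. It is coarser than the number of
    letters of each colour, but moving a single letter to another colour already
    changes it. *)
Definition colour_sum w : nat := (\sum_k lcolour (w k).1.1)%N.

Lemma colour_sum_perm w s : colour_sum (wperm w s) = colour_sum w.
Proof.
by rewrite /colour_sum [RHS](reindex_inj (@perm_inj _ s)); apply: eq_bigr => k _;
  rewrite ffunE.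
Qed.

Lemma adjacent_exists (j : 'I_n) : exists i, adjacent j i.
Proof.
case: (ltnP j.+1 n) => [lt|le]; first by exists (Ordinal lt); rewrite /adjacent eqxx orbT.
have lt : (j.-1 < n)%N by apply: leq_ltn_trans (leq_pred _) (ltn_ord j).
exists (Ordinal lt); rewrite /adjacent /= prednK ?eqxx //.
by move: le (ltn_ord j); lia.
Qed.

Lemma adjacent_neq (i j : 'I_n) : adjacent i j -> i != j.
Proof. by move=> h; apply/eqP => E; move: h; rewrite E /adjacent; lia. Qed.

(** c_j = a_(j,i) a_(i,j) for a neighbour i of j, and a_(k,j) = e_k a_(k,j). *)
Lemma zbasis_factor (b : zbasis n) : (if b is Ze _ then false else true) ->
  exists b1 b2, zmul b1 b2 = Some b /\ lcolour b2 != rcolour b.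
Proof.
case: b => // [j|k j kj] _.
  have [i ji] := adjacent_exists j.
  exists (Za ji), (Za (etrans (adjacent_sym i j) ji)); rewrite /= !eqxx; split=> //.
  by rewrite eq_sym; apply: adjacent_neq.
by exists (Ze k), (Za kj); rewrite /= eqxx; split=> //; apply: adjacent_neq.
Qed.

Lemma zmul_rcolour (b : zbasis n) : zmul b (Ze (rcolour b)) = Some b.
Proof. by case: b => *; rewrite /= eqxx. Qed.

(** The letter at one position i0 of positive degree is factored through another
    colour, all others as b = b e_j. The middle matrix indices are chosen equal
    exactly for equal letters e_j: equal letters then have equal factors, and
    all remaining letters are separated, as [eta_rigid] demands. *)
Lemma eta_factor w : valid w -> degree w != 0%N ->
  exists u v, [/\ valid u, valid v,
    eta w = eta u * eta v \/ eta w = - (eta u * eta v) &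
    colour_sum (left_unit v) != colour_sum (right_unit w)].
Proof.
move=> /[dup] vw /validP vw' dw.
have /existsP[i0 di0] : [exists i0, letter_degree (w i0) != 0%N].
  by rewrite -negb_forall; apply: contra dw; rewrite /degree sum_nat_eq0.
have [|b1 [b2 [b12 col]]] := @zbasis_factor (w i0).1.1.
  by move: di0; rewrite /letter_degree; case: (w i0).1.1.
(* Positions that share a middle index. *)
pose R k l := (k == l) || (w k == w l) && (letter_degree (w k) == 0%N).
have Rsym k l : R k l = R l k.
  by rewrite /R eq_sym [w k == _]eq_sym; case: eqP => //= _; case: eqP => // ->.
have Rtrans l k j : R k l -> R l j -> R k j.
  case/predU1P => [-> //|/andP[/eqP E dk]] /predU1P[<-|/andP[/eqP E' _]].
    by rewrite /R E eqxx -E dk orbT.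
  by rewrite /R E E' eqxx -E' -E dk orbT.
(* The middle index of a class is its first position, read in [m]. *)
pose t k : 'I_m := widen_ord d_le_m (odflt k [pick l | R k l]).
have tR k l : t k = t l -> R k l.
  move=> /(congr1 val) /= /val_inj.
  case: pickP => [i /= ki|/(_ k)]; last by rewrite /R eqxx.
  case: pickP => [j /= lj|/(_ l)]; last by rewrite /R eqxx.
  by move=> E; apply: Rtrans ki _; rewrite Rsym E.
have Rt k l : R k l -> t k = t l.
  move=> kl; rewrite /t (@eq_pick _ (R k) (R l)); last first.
    by move=> i; apply/idP/idP; apply: Rtrans; rewrite // Rsym.
  by case: pickP => // /(_ l); rewrite /R eqxx.
pose f k := if k == i0 then (b1, b2) else ((w k).1.1, Ze (rcolour (w k).1.1)).
have Rf k l : R k l -> f k = f l.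
  case/predU1P => [-> //|/andP[/eqP E dk]].
  have nk : k != i0 by apply: contraL dk => /eqP ->.
  have nl : l != i0 by apply: contraL dk => /eqP E'; rewrite E E'.
  by rewrite /f (negPf nk) (negPf nl) E.
have Re k l : k != l -> R k l -> exists j, f k = (Ze j, Ze j).
  move=> nkl; rewrite /R (negPf nkl) => /andP[_ dk].
  have nk : k != i0 by apply: contraL dk => /eqP ->.
  rewrite /f (negPf nk); move: dk; rewrite /letter_degree.
  by case: (w k).1.1 => // j _; exists j.
have Rw k l : R k l -> w k = w l by case/predU1P => [-> //|/andP[/eqP]].
pose u : word := [ffun k => ((f k).1, (w k).1.2, t k)].
pose v : word := [ffun k => ((f k).2, t k, (w k).2)].
have uR k l : u k = u l -> R k l by move/(congr1 snd); rewrite !ffunE => /tR.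
have vR k l : v k = v l -> R k l by move/(congr1 (fun x => x.1.2)); rewrite !ffunE => /tR.
have Ru k l : R k l -> u k = u l.
  by move=> kl; rewrite !ffunE (Rf _ _ kl) (Rw _ _ kl) (Rt _ _ kl).
have Rv k l : R k l -> v k = v l.
  by move=> kl; rewrite !ffunE (Rf _ _ kl) (Rw _ _ kl) (Rt _ _ kl).
have vu : valid u.
  apply/validP => k l nkl /uR /(Re _ _ nkl)[j E]; by rewrite ffunE E.
have vv : valid v.
  apply/validP => k l nkl /vR /(Re _ _ nkl)[j E]; by rewrite ffunE E.
exists u, v; split=> //.
  apply: eta_rigid => //.
  - apply: cfact1 => k l ck /uR kl; apply/eqP; move: ck; apply: contraLR => nkl.
    by have [j E] := Re _ _ nkl kl; rewrite /is_c ffunE E.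
  - apply: cfact1 => k l ck /vR kl; apply/eqP; move: ck; apply: contraLR => nkl.
    by have [j E] := Re _ _ nkl kl; rewrite /is_c ffunE E.
  - apply/wmulP => k; rewrite !ffunE /lmul /= eqxx /f.
    case: eqP => [->|_] /=; first by rewrite b12 /=; case: (w i0) => [[]].
    by rewrite zmul_rcolour /=; case: (w k) => [[]].
  - move=> k l c /lmul_colour[_]; rewrite !ffunE /= => /tR kl _ _ _.
    by have := Rv _ _ kl; rewrite !ffunE.
  - move=> k l wkl nc; apply: Ru; rewrite /R; case: eqVneq => //= nkl.
    rewrite wkl eqxx -wkl /=; have := vw' _ _ nkl wkl; move: nc.
    by rewrite /is_c /lodd /letter_degree; case: (w k).1.1.
  - move=> k l ck /uR; rewrite /R => /predU1P[//|/andP[_]]; move: ck.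
    by rewrite /is_c /letter_degree; case: (w k).1.1.
rewrite /colour_sum (bigD1 i0) //= [X in _ != X](bigD1 i0) //=.
rewrite (eq_bigr (fun k => lcolour (right_unit w k).1.1 : nat)) => [|k nk].
  by rewrite eqn_add2r !ffunE /= /f eqxx.
by rewrite !ffunE /= /f (negPf nk).
Qed.

End PositiveDegree.

(** * Triangular decomposition in degree zero *)

Section Triangular.
Variables n m d : nat.
Local Notation letter := (letter n m).
Local Notation word := (word n m d).
Local Notation tpow := (tpow n m d).
Local Notation zigzag_schurZ := (@zigzag_schurZ n m d).
Implicit Types (x y : letter) (u w z : word).

(** A matrix position (r, s) is reached by the lower triangular (r, t) followed by
    the upper triangular (t, s), with t = min(r, s). *)
Definition row_min x : 'I_m := if (x.1.2 <= x.2)%N then x.1.2 else x.2.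
Definition lower_letter x : letter := (x.1.1, x.1.2, row_min x).
Definition upper_letter x : letter := (x.1.1, row_min x, x.2).
Definition lower w : word := [ffun k => lower_letter (w k)].
Definition upper w : word := [ffun k => upper_letter (w k)].
Definition min_sum w : nat := (\sum_k row_min (w k))%N.

Lemma row_minE x : row_min x = minn x.1.2 x.2 :> nat.
Proof. by rewrite /row_min minnE; case: leqP; lia. Qed.

Lemma min_sum_perm w s : min_sum (wperm w s) = min_sum w.
Proof.
by rewrite /min_sum [RHS](reindex_inj (@perm_inj _ s)); apply: eq_bigr => k _;
  rewrite ffunE.
Qed.

Lemma degree_lower w : degree (lower w) = degree w.
Proof. by apply: eq_bigr => k _; rewrite ffunE. Qed.

Lemma degree_upper w : degree (upper w) = degree w.
Proof. by apply: eq_bigr => k _; rewrite ffunE. Qed.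

Lemma orb_card (P : pred letter) u z : orb u z ->
  #|[set k | P (z k)]| = #|[set k | P (u k)]|.
Proof.
move=> /orbP[s ->]; rewrite -(card_imset _ (@perm_inj _ s)); apply: eq_card => k.
apply/imsetP/idP => [[i]|]; rewrite !inE ?ffunE; first by move=> H ->.
by move=> H; exists (s^-1%g k); rewrite ?permKV // inE ffunE permKV.
Qed.

Lemma card_orb u z :
  (forall x, #|[set k | z k == x]| = #|[set k | u k == x]|) -> orb u z.
Proof.
move=> H; have /tuple_permP[s /val_inj E] :
    perm_eq [tuple z k | k < d] [tuple u k | k < d].
  have cE w x : count_mem x [tuple w k | k < d] = #|[set k | w k == x]|.
    by rewrite -sum1_count big_map big_enum_cond /= -sum1dep_card.
  by apply/allP => x _ /=; rewrite !cE H.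
apply/orbP; exists s; apply/ffunP => k; rewrite ffunE.
by have := congr1 (fun t => tnth t k) E; rewrite !tnth_mktuple.
Qed.

Lemma card_predU (P Q : pred 'I_d) : (forall k, P k -> Q k -> False) ->
  #|[set k | P k || Q k]| = (#|[set k | P k]| + #|[set k | Q k]|)%N.
Proof.
move=> PQ; have -> : [set k | P k || Q k] = [set k | P k] :|: [set k | Q k].
  by apply/setP => k; rewrite !inE.
rewrite cardsU (_ : _ :&: _ = set0) ?cards0 ?subn0 //.
by apply/setP => k; rewrite !inE; apply/negP => /andP[]; apply: PQ.
Qed.

Lemma upper_letter_eq x y : (x.1.2 < x.2)%N -> (upper_letter y == x) = (y == x).
Proof.
case: x y => [[b r] s] [[b' r'] s'] /= rs; rewrite !xpair_eqE -!val_eqE /= row_minE /=.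
by case: (b' == b) => //=; apply/idP/idP; lia.
Qed.

Lemma lower_letter_eq x y : (x.2 < x.1.2)%N -> (lower_letter y == x) = (y == x).
Proof.
case: x y => [[b r] s] [[b' r'] s'] /= rs; rewrite !xpair_eqE -!val_eqE /= row_minE /=.
by case: (b' == b) => //=; apply/idP/idP; lia.
Qed.

(** A diagonal entry of the lower factor comes either from a diagonal entry or
    from an entry strictly above the diagonal; the latter are visible in the
    upper factor. *)
Lemma lower_letter_diag x y : x.2 = x.1.2 -> (lower_letter y == x) =
  (y == x) || ((upper_letter y).1 == x.1) && (x.1.2 < (upper_letter y).2)%N.
Proof.
case: x y => [[b r] s] [[b' r'] s'] /= ->; rewrite !xpair_eqE -!val_eqE /= row_minE /=.
by case: (b' == b) => //=; apply/idP/idP; lia.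
Qed.

(** Entries below the diagonal are counted by the lower factor, those above it by
    the upper factor, and the diagonal ones by the difference of the two. *)
Lemma lower_upper_orb u z :
  orb (lower u) (lower z) -> orb (upper u) (upper z) -> orb u z.
Proof.
move=> Hlo Hup; apply: card_orb => x.
have [rs|sr|/val_inj rs] := ltngtP x.1.2 x.2.
- suff E w : #|[set k | w k == x]| = #|[set k | upper w k == x]|.
    by rewrite (E z) (E u) (orb_card (pred1 x) Hup).
  by apply: eq_card => k; rewrite !inE ffunE upper_letter_eq.
- suff E w : #|[set k | w k == x]| = #|[set k | lower w k == x]|.
    by rewrite (E z) (E u) (orb_card (pred1 x) Hlo).
  by apply: eq_card => k; rewrite !inE ffunE lower_letter_eq.
pose Q (y : letter) := (y.1 == x.1) && (x.1.2 < y.2)%N.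
have E w : #|[set k | lower w k == x]| =
    (#|[set k | w k == x]| + #|[set k | Q (upper w k)]|)%N.
  rewrite -card_predU => [|k /eqP wk]; last first.
    by rewrite /Q ffunE wk /= -rs ltnn andbF.
  by apply: eq_card => k; rewrite !inE !ffunE lower_letter_diag.
by have := orb_card (pred1 x) Hlo; rewrite /= (E z) (E u) (orb_card Q Hup) => /addIn.
Qed.

(** In a product of a lower and an upper triangular word the middle index is at
    most the row and at most the column of each letter, while the sum of the
    middle indices is fixed. So [min_sum] grows, unless every middle index is
    already the minimum. *)
Lemma lower_upper_product u a b z : degree u = 0%N ->
  orb (lower u) a -> orb (upper u) b -> wmul a b == Some z ->
  [/\ degree z = 0%N, (min_sum u <= min_sum z)%N &
      min_sum u = min_sum z -> a = lower z /\ b = upper z].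
Proof.
move=> u0 ua ub abz; have abz' := wmulP _ _ _ abz.
have a0 : degree a = 0%N by have /orbP[s ->] := ua; rewrite degree_perm degree_lower.
have b0 : degree b = 0%N by have /orbP[s ->] := ub; rewrite degree_perm degree_upper.
have z0 : degree z = 0%N by rewrite (degreeM abz) a0 b0.
have au k : ((a k).2 <= (a k).1.2)%N.
  by have /orbP[s ->] := ua; rewrite !ffunE /= row_minE geq_minl.
have bu k : ((b k).1.2 <= (b k).2)%N.
  by have /orbP[s ->] := ub; rewrite !ffunE /= row_minE geq_minr.
have uE : min_sum u = (\sum_k (a k).2)%N.
  have /orbP[s ->] := ua; rewrite /min_sum (reindex_inj (@perm_inj _ s)).
  by apply: eq_bigr => k _; rewrite !ffunE.
have le k : ((a k).2 <= row_min (z k))%N.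
  have [_ E _ E1 E2] := lmul_colour (abz' k).
  by rewrite row_minE leq_min E1 E2 au E bu.
have [le_sum eq_sum] := leqif_sum (fun k (_ : xpredT k) => leqif_eq (le k)).
rewrite uE; split=> // /eqP; rewrite eq_sum => /forallP /= min_z.
suff E k : a k = lower_letter (z k) /\ b k = upper_letter (z k).
  by split; apply/ffunP => k; rewrite ffunE; have [] := E k.
have [_ E col E1 E2] := lmul_colour (abz' k).
have [i ai] := degree0_vertex a0 k; have [j bj] := degree0_vertex b0 k.
have [l zl] := degree0_vertex z0 k.
move: col; rewrite ai bj zl /= => -[li lj]; subst i j.
move: (min_z k) => /eqP/val_inj; rewrite /lower_letter /upper_letter E1 E2 zl.
move: ai bj E; case: (a k) (b k) => [[ba ra] sa] [[bb rb] sb] /= -> -> <- <-.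
by [].
Qed.

(** The product of the triangular factors contains u with coefficient 1, and
    besides only words with larger [min_sum], by [lower_upper_product]. *)
Lemma eta_triangular u : degree u = 0%N -> exists y : tpow,
  [/\ y \in zigzag_schurZ,
      forall z, ~~ ((degree z == 0%N) && (min_sum u < min_sum z)%N) -> y z = 0 &
      eta u = eta (lower u) * eta (upper u) - y].
Proof.
move=> u0; have lo0 : degree (lower u) = 0%N by rewrite degree_lower.
have up0 : degree (upper u) = 0%N by rewrite degree_upper.
have Zu : eta u \in zigzag_schurZ by apply/eta_zigzag/even_valid/degree0_even.
have Zx : eta (lower u) * eta (upper u) \in zigzag_schurZ.
  by apply: zigzagM; apply/eta_zigzag/even_valid/degree0_even.
exists (eta (lower u) * eta (upper u) - eta u); split; last by rewrite subKr.
  exact: zigzagB.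
pose t z a b := gam a b z * (eta (lower u) a * eta (upper u) b).
have supp z a b : t z a b != 0 -> [/\ orb (lower u) a, orb (upper u) b & wmul a b == Some z].
  rewrite /t !degree0_eta // !mulf_eq0 !negb_or.
  case/and3P => g0 /xi_neq0 ua /xi_neq0 ub; split=> //.
  by move: g0; rewrite /gam; case: ifP.
have xu : (eta (lower u) * eta (upper u)) u = 1.
  rewrite tpowM (bigD1 (lower u)) //= (bigD1 (upper u)) //= ?big1 ?addr0.
  - rewrite !degree0_eta // !xi_self /gam even_cross_sign; last exact: degree0_even.
    rewrite ifT ?mulr1 //; apply/wmulP => k; rewrite !ffunE /lmul /= eqxx.
    by case: (u k) (degree0_vertex u0 k) => [[b r] s] /= [j ->] /=; rewrite eqxx.
  - move=> a; apply: contraNeq => /sum_neq0[b] /supp[ua ub abu].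
    by have [_ _ [//|-> _]] := lower_upper_product u0 ua ub abu.
  - move=> b; apply: contraNeq => /supp[ua ub abu].
    by have [_ _ [//|_ ->]] := lower_upper_product u0 ua ub abu.
move=> z; rewrite tpowD tpowN; have [uz _|nuz] := boolP (orb u z).
  apply/eqP; rewrite subr_eq0; apply/eqP.
  apply: schur_eq_orb uz; rewrite ?zigzag_schurZ_sub //.
  by rewrite xu degree0_eta // xi_self.
rewrite [eta u z]eta_out // subr0; apply: contraNeq.
rewrite tpowM => /sum_neq0[a] /sum_neq0[b] /supp[ua ub abz].
have [-> le eq] := lower_upper_product u0 ua ub abz.
rewrite eqxx ltn_neqAle le andbT /=; apply: contra nuz => /eqP /eq[az bz].
by apply: lower_upper_orb; rewrite -?az -?bz.
Qed.

End Triangular.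

(** * Splitting an extension by a complement *)

Section Modules.
Variable R : pzRingType.

Lemma irreducible_ind (L : lmodType R) (U : L -> Prop) : irreducible_module L ->
  U 0 -> (forall a x y, U x -> U y -> U (a *: x + y)) ->
  (exists2 x, U x & x <> 0) -> forall x, U x.
Proof.
move=> [_ irrL] U0 UL [x Ux xn0] y.
have [|UE|UE] := irrL [pred z | `[< U z >]].
- split=> [|a u v]; rewrite !inE; first exact/asboolP.
  by move=> /asboolP Uu /asboolP Uv; apply/asboolP/UL.
- by have := UE x; rewrite !inE (asboolT Ux) => /esym/eqP.
by have := UE y; rewrite !inE => /asboolP.
Qed.

(** U is a complement of N in the middle term: projecting along U is a retraction
    onto N, and with the projection to M it gives the equivalence. *)
Lemma extension_splits (M N : lmodType R) (E : extension M N) (U : ext_mod E -> Prop) :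
  (forall a x y, U x -> U y -> U (a *: x + y)) ->
  (forall y, U (ext_inj E y) -> y = 0) ->
  (forall x, exists y, U (x - ext_inj E y)) ->
  extension_equiv E (split_extension M N).
Proof.
move=> UL Uinj Uex.
have UB x y : U x -> U y -> U (x - y).
  by move=> Ux Uy; have := UL (-1) _ _ Uy Ux; rewrite scaleN1r addrC.
pose rho x := projT1 (cid (Uex x)).
have rhoP x : U (x - ext_inj E (rho x)) by exact: (projT2 (cid (Uex x))).
have rho_uniq x y : U (x - ext_inj E y) -> rho x = y.
  move=> Uy; apply/eqP; rewrite -subr_eq0; apply/eqP/Uinj.
  have := UB _ _ Uy (rhoP x); rewrite opprD opprK addrACA subrr add0r.
  by rewrite [X in U X]addrC linearB.
pose f x : N * M := (rho x, ext_proj E x).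
have f_linear : linear f.
  move=> a x y; congr pair; last by rewrite linearP.
  apply: rho_uniq; rewrite linearP /=.
  have -> : a *: x + y - (a *: ext_inj E (rho x) + ext_inj E (rho y)) =
      a *: (x - ext_inj E (rho x)) + (y - ext_inj E (rho y)).
    by rewrite scalerBr opprD addrACA.
  exact: UL.
pose F : {linear ext_mod E -> (N * M)%type} :=
  HB.pack f (GRing.isLinear.Build R (ext_mod E) (N * M)%type *:%R f f_linear).
have proj_inj y : ext_proj E (ext_inj E y) = 0 by apply/ext_exact; exists y.
have rho_inj y : rho (ext_inj E y) = y.
  by apply: rho_uniq; have := UB _ _ (rhoP 0) (rhoP 0); rewrite !subrr.
exists F; split=> [|y|//]; last by rewrite /= /f rho_inj proj_inj.
have f_inj : injective f.
  move=> x y [Er Ep]; apply/eqP; rewrite -subr_eq0; apply/eqP.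
  have [|z Ez] := (ext_exact (x - y)).1; first by rewrite linearB Ep subrr.
  rewrite -Ez -[z]rho_inj Ez; have := f_linear (-1) y x.
  by rewrite /f => -[]; rewrite !scaleN1r Er [- y + x]addrC addNr => -> _; rewrite linear0.
have f_surj p : exists x, f x = p.
  case: p => y z; have [x xz] := ext_surj E z.
  exists (x + ext_inj E (y - rho x)); congr pair.
    apply: rho_uniq; rewrite -addrA -linearB addrAC subrr sub0r linearN; exact: rhoP.
  by rewrite linearD xz proj_inj addr0.
exists (fun p => projT1 (cid (f_surj p))) => [x|p].
  exact/f_inj/(projT2 (cid (f_surj (f x)))).
exact: (projT2 (cid (f_surj p))).
Qed.

End Modules.

(** * Modules over the zigzag Schur algebra *)

Section Action.
Variables (k : fieldType) (n m d : nat).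
Local Notation word := (word n m d).
Local Notation tpow := (tpow n m d).
Local Notation zigzag_schurZ := (@zigzag_schurZ n m d).
Local Notation T := (tensor k (zigzag_schur_int n m d)).
Implicit Types (x y : tpow) (w u : word).

(** Total, so that the action below takes plain tensors; the value 0 outside the
    integral form is a default. *)
Definition to_int x : zigzag_schur_int n m d := insubd (0 : zigzag_schur_int n m d) x.

Lemma to_intK x : x \in zigzag_schurZ -> val (to_int x) = x.
Proof. exact: insubdK. Qed.

Definition zact (M : lmodType T) x (v : M) : M := (pure_tensor (1 : k) (to_int x) : T) *: v.
Definition kscale (M : lmodType T) (c : k) (v : M) : M :=
  (pure_tensor c (1 : zigzag_schur_int n m d) : T) *: v.

Section OneModule.
Variable M : lmodType T.
Implicit Types (a b v : M).

Lemma zact_linear (N : lmodType T) (f : {linear M -> N}) x v : f (zact x v) = zact x (f v).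
Proof. exact: linearZ. Qed.

Lemma kscale_linear (N : lmodType T) (f : {linear M -> N}) c v :
  f (kscale c v) = kscale c (f v).
Proof. exact: linearZ. Qed.

Lemma zactM x y v : x \in zigzag_schurZ -> y \in zigzag_schurZ ->
  zact (x * y) v = zact x (zact y v).
Proof.
move=> Zx Zy; rewrite /zact scalerA; congr (_ *: _).
rewrite [RHS]pure_tensorM mul1r; congr pure_tensor; apply: val_inj.
by rewrite to_intK ?zigzagM // rmorphM /= !to_intK.
Qed.

Lemma zactB x y v : x \in zigzag_schurZ -> y \in zigzag_schurZ ->
  zact (x - y) v = zact x v - zact y v.
Proof.
move=> Zx Zy; rewrite /zact -scalerBl; congr (_ *: _).
have [_ fr] := pure_tensor_biadditive k (zigzag_schur_int n m d).
apply: (addIr (pure_tensor 1 (to_int y) : T)); rewrite -fr subrK; congr pure_tensor.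
by apply: val_inj; rewrite rmorphD /= !to_intK ?zigzagB // subrK.
Qed.

Lemma zact1 v : zact 1 v = v.
Proof.
rewrite /zact (_ : to_int 1 = 1) ?scale1r //; apply: val_inj.
by rewrite to_intK ?rmorph1 // zigzag_schurZ1.
Qed.

Lemma zact0 v : zact 0 v = 0.
Proof. by have := zactB v (zigzag_schurZ1 n m d) (zigzag_schurZ1 n m d); rewrite !subrr. Qed.

Lemma zactDr x a b : zact x (a + b) = zact x a + zact x b.
Proof. exact: scalerDr. Qed.

Lemma zact_r0 x : zact x (0 : M) = 0.
Proof. exact: scaler0. Qed.

Lemma kscale_act c x v : kscale c (zact x v) = zact x (kscale c v).
Proof.
rewrite /kscale /zact !scalerA; congr (_ *: _).
by rewrite [LHS]pure_tensorM [RHS]pure_tensorM !mulr1 !mul1r.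
Qed.

Lemma kscaleA c c' v : kscale c (kscale c' v) = kscale (c * c') v.
Proof. by rewrite /kscale scalerA; congr (_ *: _); rewrite [LHS]pure_tensorM mulr1. Qed.

Lemma kscale1 v : kscale 1 v = v.
Proof. exact: scale1r. Qed.

Lemma kscaleDl c c' v : kscale (c + c') v = kscale c v + kscale c' v.
Proof.
rewrite /kscale -scalerDl; congr (_ *: _).
by have [-> _] := pure_tensor_biadditive k (zigzag_schur_int n m d).
Qed.

Lemma kscale0 v : kscale 0 v = 0.
Proof. by apply: (addrI (kscale 0 v)); rewrite -kscaleDl !addr0. Qed.

Lemma kscaleN1 v : kscale (-1) v = - v.
Proof. by apply: (addrI v); rewrite -{1}(kscale1 v) -kscaleDl !subrr kscale0. Qed.

Definition subspace (K : M -> Prop) :=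
  [/\ K 0, forall a b, K a -> K b -> K (a + b) & forall c a, K a -> K (kscale c a)].

(** The integral form is spanned by the orbit sums, so a subspace condition can be
    checked on these, and only on those in the support of x. *)
Lemma zact_span (K : M -> Prop) (P : pred word) x v : subspace K -> perm_invariant P ->
  x \in zigzag_schurZ -> (forall w, ~~ P w -> x w = 0) ->
  (forall w, valid w -> P w -> K (zact (eta w) v)) -> K (zact x v).
Proof.
case=> K0 KD KZ iP Zx x0 Kw; have [c ->] := zigzag_span iP Zx x0.
pose J y := y \in zigzag_schurZ /\ K (zact y v).
suff [] : J (\sum_(w | valid w && P w) eta w *~ c w) by [].
have J0 : J 0 by split; rewrite ?zact0 // -(subrr x) zigzagB.
have JB y z : J y -> J z -> J (y - z).
  move=> [Zy Ky] [Zz Kz]; split; first exact: zigzagB.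
  by rewrite zactB // -kscaleN1; apply/KD/KZ.
have JN y : J y -> J (- y) by rewrite -sub0r; apply: JB.
have JD y z : J y -> J z -> J (y + z) by move=> Jy /JN; rewrite -{2}[z]opprK; apply: JB.
apply: (big_ind J) => // w /andP[vw Pw].
have Jn i : J (eta w *+ i).
  elim: i => [|i Ji]; first by rewrite mulr0n.
  by rewrite mulrS; apply: JD Ji; split; [exact: eta_zigzag | exact: Kw].
by case: (c w) => i; rewrite ?NegzE ?mulrNz; [|apply: JN]; apply: Jn.
Qed.

Lemma scale_span (K : M -> Prop) v : subspace K ->
  (forall w, valid w -> K (zact (eta w) v)) -> forall t : T, K (t *: v).
Proof.
move=> sK Kw t; have [K0 KD KZ] := sK; have [s ->] := tensor_sum t.
rewrite scaler_suml; apply: big_ind => // -[c a] _ /=.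
have -> : pure_tensor c a *: v = kscale c (zact (val a) v).
  rewrite /kscale /zact scalerA; congr (_ *: _).
  by rewrite [RHS]pure_tensorM mulr1 mul1r /to_int valKd.
apply: KZ; apply: (@zact_span K xpredT) => //; first exact: (valP a).
by move=> w vw _; apply: Kw.
Qed.

End OneModule.
End Action.

(** * Irreducible modules *)

Section Radical.
Variables (k : fieldType) (n m d : nat).
Local Notation word := (word n m d).
Local Notation tpow := (tpow n m d).
Local Notation zigzag_schurZ := (@zigzag_schurZ n m d).
Local Notation T := (tensor k (zigzag_schur_int n m d)).
Variables (L : lmodType T) (irrL : irreducible_module L).
Implicit Types (x y : tpow) (w u : word) (l : L).

Definition order_ge i x := forall w, (degree w < i)%N -> x w = 0.

Lemma order_geM i j x y : order_ge i x -> order_ge j y -> order_ge (i + j) (x * y).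
Proof.
move=> Hx Hy w dw; apply/eqP; rewrite tpowM; apply/negP => /negP.
move=> /sum_neq0[u] /sum_neq0[v]; rewrite !mulf_eq0 !negb_or /gam.
case: ifP => // /degreeM dE; case/and3P=> _ xu yv; move: dw; rewrite dE.
have ltu : ~~ (degree u < i)%N by apply: contra xu => /Hx ->.
have ltv : ~~ (degree v < j)%N by apply: contra yv => /Hy ->.
lia.
Qed.

Lemma degree_le w : (degree w <= d * 2)%N.
Proof.
rewrite -[X in (_ <= X * _)%N](card_ord d) -sum_nat_const; apply: leq_sum => i _.
by rewrite /letter_degree; case: (w i).1.1.
Qed.

(** The vectors killed by positive degree form a submodule. It is nonzero: start
    from any vector l <> 0 and take i maximal such that some element of order i
    does not kill l; the image of l lies in the submodule. Such an i exists since
    degrees are bounded by 2 d. *)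
Lemma radical_kills x l : x \in zigzag_schurZ -> order_ge 1 x -> zact x l = 0.
Proof.
move: l => l0 Zx0 Dx0.
pose U l := forall x, x \in zigzag_schurZ -> order_ge 1 x -> zact x l = 0.
suff : U l0 by apply.
apply: (irreducible_ind (U := U) irrL) => {x l0 Zx0 Dx0}.
- by move=> x _ _; rewrite zact_r0.
- move=> t l l' Ul Ul' x Zx Dx; rewrite zactDr Ul' // addr0.
  apply: (@scale_span _ _ _ _ L (fun b => zact x b = 0)) => [|w vw].
    split=> [|a b Ea Eb|c a Ea]; first by rewrite zact_r0.
      by rewrite zactDr Ea Eb addr0.
    by rewrite -kscale_act Ea /kscale scaler0.
  rewrite -zactM ?eta_zigzag //; apply: Ul; first by rewrite zigzagM ?eta_zigzag.
  by rewrite -[1%N]addn0; apply: order_geM.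
have [[l /eqP l0] _] := irrL.
pose Q i := `[< exists2 x, x \in zigzag_schurZ /\ order_ge i x & zact x l <> 0 >].
have Q0 : exists i, Q i.
  by exists 0%N; apply/asboolP; exists 1; rewrite ?zact1 // zigzag_schurZ1.
have Qle i : Q i -> (i <= d * 2)%N.
  move=> /asboolP[x [Zx Dx] xl]; rewrite leqNgt; apply/negP => lt; apply: xl.
  rewrite (_ : x = 0) ?zact0 //; apply/ffunP => w; rewrite ffunE.
  by apply: Dx; apply: leq_ltn_trans (degree_le w) lt.
case: (ex_maxnP Q0 Qle) => i /asboolP[x [Zx Dx] xl] max_i.
exists (zact x l) => // y Zy Dy; rewrite -zactM //; apply: contrapT => yxl.
have := max_i i.+1; rewrite ltnn => /(_ _)/notF; apply.
apply/asboolP; exists (y * x) => //; split; first exact: zigzagM.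
by rewrite -add1n; apply: order_geM.
Qed.

Definition colour_idem s : tpow := idem (fun u => colour_sum u == s).

Lemma colour_invariant s : perm_invariant (fun u : word => colour_sum u == s).
Proof. by move=> w t; rewrite colour_sum_perm. Qed.

Lemma colour_idem_zigzag s : colour_idem s \in zigzag_schurZ.
Proof. exact/idem_zigzag/colour_invariant. Qed.

(** A word of degree zero has the same colours on both sides, so the commutator
    has positive degree. *)
Lemma colour_idem_comm s x l : x \in zigzag_schurZ ->
  zact (colour_idem s) (zact x l) = zact x (zact (colour_idem s) l).
Proof.
move=> Zx; have Zc := colour_idem_zigzag s.
apply/eqP; rewrite -!zactM // -subr_eq0 -zactB ?zigzagM //; apply/eqP.
apply: radical_kills; first by rewrite zigzagB ?zigzagM.
move=> w; rewrite ltnS leqn0 => /eqP w0.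
rewrite tpowD tpowN idem_mull idem_mulr.
suff -> : colour_sum (left_unit w) = colour_sum (right_unit w) by rewrite subrr.
apply: eq_bigr => i _; rewrite !ffunE /=.
by have [j ->] := degree0_vertex w0 i.
Qed.

Lemma colour_idem_id s l1 : l1 <> 0 -> zact (colour_idem s) l1 = l1 ->
  forall l, zact (colour_idem s) l = l.
Proof.
move=> l1n0 El1; have Zc := colour_idem_zigzag s.
apply: irreducible_ind irrL _ _ _; first exact: zact_r0; last by exists l1.
move=> t l l' El El'; rewrite zactDr El'; congr (_ + _).
apply: (@scale_span _ _ _ _ L (fun b => zact (colour_idem s) b = b)) => [|w vw].
  split=> [|a b Ea Eb|c a Ea]; first by rewrite zact_r0.
    by rewrite zactDr Ea Eb.
  by rewrite -kscale_act Ea.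
by rewrite colour_idem_comm ?eta_zigzag // El.
Qed.

End Radical.

(** * Highest weight vectors in extensions *)

Section HighestWeight.
Variables (k : fieldType) (n m d : nat).
Local Notation word := (word n m d).
Local Notation tpow := (tpow n m d).
Local Notation zigzag_schurZ := (@zigzag_schurZ n m d).
Local Notation T := (tensor k (zigzag_schur_int n m d)).
Variable M : lmodType T.
Implicit Types (x y : tpow) (w u : word) (v : M) (P : pred word).

(** If the right end of w has colour sum s, then by [eta_factor] the action of
    eta_w passes through another colour sum, hence through 0; otherwise its right
    end already acts as 0. *)
Lemma positive_kills s w v : (1 < n)%N -> (d <= m)%N ->
  (forall s' v, s' != s -> zact (@colour_idem n m d s') v = 0) ->
  valid w -> degree w != 0%N -> zact (eta w) v = 0.
Proof.
move=> n1 dm other vw dw.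
have Zc s' := colour_idem_zigzag n m d s'; have Zw := eta_zigzag vw.
have [E|ns] := eqVneq (colour_sum (right_unit w)) s; last first.
  have -> : eta w = eta w * colour_idem n m d (colour_sum (right_unit w)).
    by rewrite eta_idem ?eqxx //; exact: colour_invariant.
  by rewrite zactM // other // zact_r0.
have [u [u' [vu vu' wE]]] := eta_factor n1 dm vw dw; rewrite E => ns.
have Zu := eta_zigzag vu; have Zu' := eta_zigzag vu'.
have kill : zact (eta u * eta u') v = 0.
  have -> : eta u' = colour_idem n m d (colour_sum (left_unit u')) * eta u'.
    by rewrite idem_eta ?eqxx //; exact: colour_invariant.
  by rewrite zactM ?zigzagM // [zact (_ * eta u') v]zactM // other // zact_r0.
case: wE => -> //; rewrite -sub0r zactB ?zigzagM //; first by rewrite zact0 kill subrr.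
by rewrite -(subrr (eta w)) zigzagB.
Qed.

(** Moving a letter to an earlier row, which raises a weight in the dominance
    order, lowers this number. *)
Definition height u : nat := (\sum_i (u i).1.2)%N.

Lemma height_perm u s : height (wperm u s) = height u.
Proof.
by rewrite /height [RHS](reindex_inj (@perm_inj _ s)); apply: eq_bigr => i _; rewrite ffunE.
Qed.

Lemma height_orb u w : orb u w -> height w = height u.
Proof. by move=> /orbP[s ->]; rewrite height_perm. Qed.

Lemma min_sum_le w : (min_sum w <= d * m)%N.
Proof.
rewrite -[X in (_ <= X * _)%N](card_ord d) -sum_nat_const; apply: leq_sum => i _.
exact: ltnW (ltn_ord _).
Qed.

(** The minima of rows and columns have the same sum as both only on the diagonal. *)
Lemma min_sum_unit w : degree w = 0%N ->
  (height (left_unit w) <= min_sum w)%N -> (height (right_unit w) <= min_sum w)%N ->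
  unit_word w.
Proof.
move=> w0 Hl Hr; apply/forallP => i; rewrite /is_unit_letter.
have [j ->] := degree0_vertex w0 i; rewrite /= -val_eqE /=.
have eqs (F : 'I_d -> nat) : (forall i, (row_min (w i) <= F i)%N) ->
    (\sum_i F i <= min_sum w)%N -> forall i, row_min (w i) = F i :> nat.
  move=> le_F sum_F i'; apply/eqP; move: i'; apply/forallP.
  have [le eq] := leqif_sum (fun i (_ : xpredT i) => leqif_eq (le_F i)).
  by rewrite -[[forall _, _]]eq eqn_leq le.
have -> := esym (eqs (fun i => (w i).1.2 : nat) _ _ i).
- by have -> := eqs (fun i => (w i).2 : nat) _ _ i => // [i'|]; rewrite ?row_minE ?geq_minr //;
    move: Hr; rewrite /height; under eq_bigr do rewrite ffunE.
- by move=> i'; rewrite row_minE geq_minl.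
- by move: Hl; rewrite /height; under eq_bigr do rewrite ffunE.
Qed.

(** By downward induction on [min_sum], through [eta_triangular]: the middle weight
    of the triangular factorization of w has height [min_sum w]. This is smaller
    than the height of the weight of v, so that the product acts as zero, unless w
    is diagonal and eta_w acts on v as the identity. *)
Lemma weight_line u0 v :
  (forall w v, valid w -> degree w != 0%N -> zact (eta w) v = 0) ->
  (forall u v, (height u < height u0)%N -> zact (idem (orb u)) v = 0) ->
  zact (idem (orb u0)) v = v ->
  forall t : T, exists c, zact (idem (orb u0)) (t *: v) = kscale c v.
Proof.
move=> pos low fix_v.
have Ze u : idem (orb u) \in zigzag_schurZ := idem_zigzag (@orb_invariant _ _ _ u).
pose K b := exists c, zact (idem (orb u0)) b = kscale c v.
have K0 : K 0 by exists 0; rewrite zact_r0 kscale0.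
have sK : subspace K.
  split=> // [a b [c Ea] [c' Eb]|c a [c' Ea]].
    by exists (c + c'); rewrite zactDr Ea Eb kscaleDl.
  by exists (c * c'); rewrite -kscale_act Ea kscaleA.
apply: (scale_span sK) => w vw.
have [w0|dw] := eqVneq (degree w) 0%N; last by rewrite pos.
have [N] := ubnP (d * m - min_sum w); elim: N w {vw} w0 => // N IHN w w0 leN.
have vw : valid w by apply/even_valid/degree0_even.
have Zw := eta_zigzag vw.
have [Hl|nHl] := boolP (orb u0 (left_unit w)); last first.
  exists 0; rewrite -zactM // idem_eta; last exact: orb_invariant.
  by rewrite (negPf nHl) zact0 kscale0.
have [Hr|nHr] := boolP (orb u0 (right_unit w)); last first.
  rewrite -fix_v -zactM // eta_idem; last exact: orb_invariant.
  by rewrite (negPf nHr) zact0.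
have [lt|ge] := ltnP (min_sum w) (height u0); last first.
  have uw : unit_word w.
    by apply: min_sum_unit; rewrite // ?(height_orb Hl) ?(height_orb Hr).
  exists 1; rewrite unit_eta // (_ : idem (orb w) = idem (orb u0)).
    by rewrite !fix_v kscale1.
  by apply/ffunP => z; rewrite !ffunE (orb_eql Hl z) left_unit_id.
have [y [Zy y0 ->]] := eta_triangular w0.
have Zup : eta (upper w) \in zigzag_schurZ.
  by apply/eta_zigzag/even_valid/degree0_even; rewrite degree_upper.
have Zlo : eta (lower w) \in zigzag_schurZ.
  by apply/eta_zigzag/even_valid/degree0_even; rewrite degree_lower.
rewrite zactB ?zigzagM // zactM // (_ : zact (eta (upper w)) v = 0); last first.
  have -> : eta (upper w) = idem (orb (left_unit (upper w))) * eta (upper w).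
    by rewrite idem_eta ?orb_refl //; exact: orb_invariant.
  rewrite zactM // low // (_ : height _ = min_sum w) //.
  by apply: eq_bigr => i _; rewrite !ffunE.
rewrite zact_r0 sub0r -kscaleN1; have [_ _ KZ] := sK; apply: KZ.
apply: (zact_span (P := fun z => (degree z == 0%N) && (min_sum w < min_sum z)%N)) => //.
  by move=> z s; rewrite degree_perm min_sum_perm.
move=> z _ /andP[/eqP z0 lt_wz]; apply: IHN => //.
by have := min_sum_le z; lia.
Qed.

End HighestWeight.

(** * Self-extensions *)

Section SelfExtensions.
Variables (k : fieldType) (n m d : nat).
Hypotheses (n_gt1 : (1 < n)%N) (d_le_m : (d <= m)%N).
Local Notation word := (word n m d).
Local Notation zigzag_schurZ := (@zigzag_schurZ n m d).
Local Notation T := (tensor k (zigzag_schur_int n m d)).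

(** If e kills both ends, then e x lies in the submodule and e x = e (e x) = 0. *)
Lemma idem_kills_extension (L L' : lmodType T) (E : extension L L') (P : pred word) :
  perm_invariant P -> (forall l : L, zact (idem P) l = 0) ->
  (forall l : L', zact (idem P) l = 0) ->
  forall x : ext_mod E, zact (idem P) x = 0.
Proof.
move=> iP kL kL' x; have Zp := idem_zigzag iP.
have [|y yE] := (ext_exact (zact (idem P) x)).1; first by rewrite zact_linear kL.
have <- : zact (idem P) (zact (idem P) x) = zact (idem P) x.
  rewrite -zactM // idem_idem //; congr zact; apply/ffunP => w.
  by rewrite !ffunE /= andbb.
by rewrite -yE -zact_linear kL' linear0.
Qed.

(** The weight idempotents add up to 1. *)
Lemma exists_weight (L : lmodType T) (l : L) : l <> 0 ->
  exists u : word, zact (idem (orb u)) l <> 0.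
Proof.
move=> l0; apply: contrapT => none; apply: l0; rewrite -[l]zact1.
apply: (@zact_span _ _ _ _ L (fun b => b = 0) (@unit_word n m d)).
- by split=> [//|a b -> ->|c a ->]; [rewrite addr0 | rewrite /kscale scaler0].
- exact: unit_word_perm.
- exact: zigzag_schurZ1.
- by move=> w /negPf nw; rewrite oneE nw.
move=> w _ uw; apply: contrapT => wl; apply: none; exists w.
by rewrite -unit_eta.
Qed.

Lemma Ext1_self_vanishes (L : lmodType T) : irreducible_module L -> Ext1_vanishes L L.
Proof.
move=> irrL E; have [[l0 /eqP l0n0] _] := irrL.
have Ze u : idem (orb u) \in zigzag_schurZ := idem_zigzag (@orb_invariant n m d u).
have idem2 (M : lmodType T) u (v : M) :
    zact (idem (orb u)) (zact (idem (orb u)) v) = zact (idem (orb u)) v.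
  rewrite -zactM // idem_idem; last exact: orb_invariant.
  by congr zact; apply/ffunP => w; rewrite !ffunE /= andbb.
pose W (u : word) := `[< exists l : L, zact (idem (orb u)) l <> 0 >].
have [u1 Wu1] : exists u, W u.
  by have [u Hu] := exists_weight l0n0; exists u; apply/asboolP; exists l0.
have [u0 /asboolP[l Hl] min_u0] := arg_minnP (@height n m d) Wu1.
pose l1 := zact (idem (orb u0)) l.
have fix_l1 : zact (idem (orb u0)) l1 = l1 by exact: idem2.
pose s := colour_sum u0.
have colour_l1 : zact (colour_idem n m d s) l1 = l1.
  rewrite /l1 -zactM ?colour_idem_zigzag // idem_idem; last exact: colour_invariant.
  congr zact; apply/ffunP => w; rewrite !ffunE /=.
  have [/orbP[t ->]|_] := boolP (orb u0 w); last by rewrite andbF.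
  by rewrite colour_sum_perm eqxx.
have colourL := colour_idem_id irrL Hl colour_l1.
have otherL s' (l' : L) : s' != s -> zact (colour_idem n m d s') l' = 0.
  move=> ns; rewrite -(colourL l') -zactM ?colour_idem_zigzag //.
  rewrite idem_idem; last exact: colour_invariant.
  rewrite (_ : idem _ = 0) ?zact0 //; apply/ffunP => w; rewrite !ffunE /=.
  by case: eqP => [->|]; rewrite // (negPf ns).
have otherM s' (x : ext_mod E) : s' != s -> zact (colour_idem n m d s') x = 0.
  move=> ns; apply: idem_kills_extension; first exact: colour_invariant.
    by move=> l'; exact: otherL.
  by move=> l'; exact: otherL.
have lowL u (l' : L) : (height u < height u0)%N -> zact (idem (orb u)) l' = 0.
  move=> lt; apply: contrapT => ul; have := min_u0 u; rewrite leqNgt lt => /(_ _)/notF.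
  by apply; apply/asboolP; exists l'.
have lowM u (x : ext_mod E) : (height u < height u0)%N -> zact (idem (orb u)) x = 0.
  move=> lt; apply: idem_kills_extension; first exact: orb_invariant.
    by move=> l'; exact: lowL.
  by move=> l'; exact: lowL.
have posM w (x : ext_mod E) : valid w -> degree w != 0%N -> zact (eta w) x = 0.
  exact: (positive_kills _ n_gt1 d_le_m otherM).
have [x xl] := ext_surj E l1.
pose v := zact (idem (orb u0)) x.
have fix_v : zact (idem (orb u0)) v = v by exact: idem2.
have vl : ext_proj E v = l1 by rewrite zact_linear xl.
have line := weight_line posM lowM fix_v.
apply: (@extension_splits _ _ _ E (fun a => exists t : T, a = t *: v)).
- by move=> a _ _ [t ->] [t' ->]; exists (a * t + t'); rewrite scalerDl scalerA.
- move=> y Hy; apply: contrapT => yn0.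
  (* If T v meets L, it contains all of L, in particular the vector l1. *)
  pose V (b : L) := exists t : T, ext_inj E b = t *: v.
  have VL : forall b, V b.
    apply: (irreducible_ind (U := V) irrL); last by exists y.
      by exists 0; rewrite linear0 scale0r.
    by move=> a b b' [t Et] [t' Et']; exists (a * t + t');
      rewrite linearP Et Et' scalerDl scalerA.
  have [t Et] := VL l1; have [c Ec] := line t.
  have {}Ec : ext_inj E l1 = kscale c v by rewrite -Ec -Et -zact_linear fix_l1.
  have : kscale c l1 = 0.
    by rewrite -vl -kscale_linear -Ec; apply/ext_exact; exists l1.
  have [c0 _|cn0 cl1] := eqVneq c 0.
    apply: Hl; apply: (@ext_injP _ _ _ E); rewrite linear0 -/l1 Ec c0; exact: kscale0.
  by apply: Hl; rewrite -/l1 -[l1]kscale1 -(mulVf cn0) -kscaleA cl1 /kscale scaler0.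
move=> a.
(* T v maps onto the submodule generated by l1, which is L. *)
have [t Et] : exists t : T, ext_proj E a = t *: l1.
  apply: (irreducible_ind (U := fun b => exists t : T, b = t *: l1) irrL).
  - by exists 0; rewrite scale0r.
  - by move=> c _ _ [t ->] [t' ->]; exists (c * t + t'); rewrite scalerDl scalerA.
  - by exists l1 => //; exists 1; rewrite scale1r.
have [|y yE] := (ext_exact (a - t *: v)).1.
  by rewrite linearB linearZ /= vl Et subrr.
by exists y, t; rewrite yE subKr.
Qed.

End SelfExtensions.

Theorem corollary3p15 (p : nat) (k : closedFieldType) (m d : nat)
    (p_gt2 : (2 < p)%N) (p_prime : prime p) (char_k : p \in [pchar k])
    (m_ge1 : (1 <= m)%N) (d_le_m : (d <= m)%N)
    (L : lmodType (zigzag_schur p k m d)) (irrL : irreducible_module L) :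
  Ext1_vanishes L L.
Proof.
have n_gt1 : (1 < p.-1)%N by lia.
exact: (Ext1_self_vanishes n_gt1 d_le_m irrL).
Qed.
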